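(* Fix $p\ge2$. Let $\mathcal{H}$ be the set of quadruples $(O,\mathfrak{m},c,e)$ where $O$ is an orientation (light-left or light-right), $\mathfrak{m}$ is a $p$-hypermap, $c$ is a corner of some light face of $\mathfrak{m}$, and $e$ is an edge of $\mathfrak{m}$ leaving $c^+$ for the orientation $O$. Define $\Phi(O,\mathfrak{m},c,e)$ as follows: (1) let $\tilde O$ be the reverse of $O$, and use $\tilde O$ for all subsequent notions; (2) let $c_e$ be the corner preceding $e$ (for $\tilde O$) and let $\gamma$ be the lightest geodesic (for $\tilde O$) from $c_e$ to $c^+$; (3) perform the slit-slide-sew operation along $\gamma$, entering from $c_e$ and exiting through $c$; (4) the unmatched light copy of the first edge of $\gamma$ is then a dangling edge; remove it and call $\tilde c$ the resulting corner; call $\tilde e$ the edge given by the unmatched dark copy of the last edge of $\gamma$; call $\tilde{\mathfrak{m}}$ the resulting map; set $\Phi(O,\mathfrak{m},c,e):=(\tilde O,\tilde{\mathfrak m},\tilde c,\tilde e)$. Then $\Phi$ maps $\mathcal H$ to $\mathcal H$ and is an involution.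
   Context: A plane map is an embedding of a finite connected graph (multiple edges and loops allowed) in the sphere, up to orientation-preserving homeomorphism. A $p$-hypermap is a plane map whose faces are shaded dark or light so that adjacent faces have different shades and every dark face has degree $p$; each light face carries a marked corner, which is treated as a dangling half-edge, so that a light face of degree $a$ has $a+1$ corners that can be distinguished (one on each side of the marked corner). Edges are oriented so that all light faces lie on the same side: light-left orientation (light faces to the left of every edge) or light-right orientation (light faces to the right). For an oriented edge $e$, $e^-,e^+$ are its origin and end; for a corner $c$, $c^+$ is its incident vertex. The corner preceding $e$, $c_e$, is the corner delimited by $e$ and the edge preceding $e$ in the contour of the incident light face (in the convened orientation); $c_e^+=e^-$. A path is a sequence of edges $(e_1,\dots,e_k)$ with $e_i^+=e_{i+1}^-$, using edges only in the convened orientation; its length is $k$; its light side is the side where the incident faces are light, the other is its dark side. $\vec d(u,w)$ is the minimal length of a path from $u$ to $w$; a geodesic is a path realizing it. An edge $e$ is leaving a vertex $v$ if $\vec d(v,e^+)=\vec d(v,e^-)+1$. Lightest geodesic from a starting corner or edge $e_0$ with $e_0^+=v$ to a vertex $v'$: having built $e_0,\dots,e_j$ with $e_j^+\neq v'$, $e_{j+1}$ is, among the edges $e$ with $e^-=e_j^+$ and $\vec d(e^+,v')=\vec d(e_j^+,v')-1$, the first one met when turning around $e_j^+$ starting from $e_j$ in the direction going from $e_j$ towards the incident light face (this is the leftmost geodesic in the light-left orientation and the rightmost in the light-right orientation). Slit-slide-sew: given a simple path $(e_1,\dots,e_k)$ from a corner $c$ (with $e_1^-=c^+$) to a different corner $c'$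 (with $e_k^+=c'^+$), follow the path on the sphere entering from $c$ and exiting through $c'$, and slit the sphere along it; this doubles the path into a copy $(\ell_1,\dots,\ell_k)$ incident to light faces and a copy $(d_1,\dots,d_k)$ incident to dark faces. Then sew back by matching $\ell_{i+1}$ with $d_i$ for $1\le i\le k-1$, leaving $\ell_1$ and $d_k$ unmatched; when $c$ is the corner preceding $e_1$, $\ell_1$ becomes a dangling edge. *)

(* Defs.v *)
From mathcomp Require Import all_boot.

Set Implicit Arguments.
Unset Strict Implicit.
Unset Printing Implicit Defensive.

(* Maps are encoded by their darts. A dart is either a side of an edge,
   directed so that the face it borders lies on its left, or a dangling
   half-edge (a fixed point of [opp]).
   - [face x] is the dart following [x] in the contour of the face of [x];
     going along a dangling half-edge means going out and back.
   - [opp x] is the other side of the edge of [x].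
   - [dark x] is the shade of the face of [x].
   A dart [x] also stands for
   - a vertex: the origin of [x];
   - a half-edge: the one of [x] at the origin of [x];
   - a corner: the one of the face of [x] located between the dart preceding
     [x] in the contour and [x]. A light face of degree [a] with a dangling
     half-edge in its marked corner thus has [a + 1] corners.
   The fields of [premap] are unconstrained; see [phypermap]. *)
Record premap := Premap {
  dart : finType;
  face : dart -> dart;
  opp : dart -> dart;
  dark : pred dart
}.

Section Maps.
Variable m : premap.
Implicit Types x y u v w c e h : dart m.

(* Next half-edge, clockwise, around the origin of [x]. *)
Definition node x := face (opp x).

Definition same_vertex x y := fconnect node x y.

Definition dangling x := opp x == x.

Definition connected_map : Prop :=
  forall x y,
    connect [rel a b : dart m | (b == face a) || (b == opp a)] x y.

(* Euler's relation. The map reduced to one vertex is the one whose single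
   dart is dangling. *)
Definition planar : Prop :=
  fcard node (dart m) + fcard (@face m) (dart m)
  = fcard (@opp m) [predC dangling] + 2.

Definition plane_map : Prop :=
  [/\ bijective (@face m), involutive (@opp m), connected_map & planar].

Definition phypermap (p : nat) : Prop :=
  [/\ plane_map,
      forall x, dark (face x) = dark x,
      forall x, ~~ dangling x -> dark (opp x) = ~~ dark x,
      forall x, dark x -> ~~ dangling x /\ order (@face m) x = p
    & forall x, ~~ dark x ->
        #|[pred y | fconnect (@face m) x y & dangling y]| = 1].

(* An edge of a hypermap is represented by its light side. *)
Definition is_edge x := ~~ dark x && ~~ dangling x.

Definition is_light_corner x := ~~ dark x.

End Maps.

Inductive orientation := LightLeft | LightRight.

Definition reverse O :=
  match O with LightLeft => LightRight | LightRight => LightLeft end.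

Section Oriented.
Variables (O : orientation) (m : premap).
Implicit Types x y u v w c e h : dart m.

(* The half-edges of [e] at its origin and at its end; in the light-left
   orientation, [e] is directed as its light side. *)
Definition src e := if O is LightLeft then e else opp e.
Definition tgt e := if O is LightLeft then opp e else e.

Fixpoint is_path u (s : seq (dart m)) w :=
  if s is e :: s' then
    [&& is_edge e, same_vertex u (src e) & is_path (tgt e) s' w]
  else same_vertex u w.

(* A shortest path has fewer edges than there are darts; the value is
   [#|dart m|] when there is no path. *)
Definition dist u w :=
  find (fun n => [exists s : n.-tuple (dart m), is_path u s w])
       (iota 0 #|dart m|).

Definition leaving v e := dist v (tgt e) == (dist v (src e)).+1.

(* The corner delimited by [e] and what precedes it, possibly a dangling
   half-edge, in the contour of its light face. *)
Definition corner_preceding e := if O is LightLeft then e else face e.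

(* [turn h] is the half-edge following [h] around its vertex, in the direction
   going from the end [tgt e] of an edge to the light face incident to [e]:
   clockwise for light-left, counterclockwise for light-right. *)
Definition turn h :=
  if O is LightLeft then node h else opp (finv (@face m) h).

(* The half-edge from which [turn] crosses the corner [c]. *)
Definition corner_start c :=
  if O is LightLeft then opp (finv (@face m) c) else c.

(* The edge whose half-edge at its origin is [h]. *)
Definition edge_from h := if O is LightLeft then h else opp h.

Definition lightest_candidates h w :=
  [seq e <- [seq edge_from x | x <- orbit turn (turn h)]
     | is_edge e && ((dist (tgt e) w).+1 == dist h w)].

Fixpoint lightest_rec n h w : seq (dart m) :=
  if n is n'.+1 then
    if same_vertex h w then [::]
    else if lightest_candidates h w is e :: _
         then e :: lightest_rec n' (tgt e) w
         else [::]
  else [::].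

(* The bound on the number of steps is harmless, see [dist]. *)
Definition lightest_geodesic c w :=
  lightest_rec #|dart m| (corner_start c) w.

End Oriented.

(* Slit-slide-sew along the path [e1 :: s], entering from the corner [c] and
   exiting through the corner [c']. The copies [l_i] and [d_i] of the edges keep
   the darts of the light and dark sides of the [e_i]. The unmatched [l_1] and
   [d_k] get new darts on their other sides, [inr true] and [inr false]
   respectively; as the slit is open at [c] and [c'], these new sides are
   inserted in the contours of the light faces there, at [c] and at [c']. *)
Section SlitSlideSew.
Variables (m : premap) (c c' e1 : dart m) (s : seq (dart m)).

Let lights := e1 :: s.
Let darks := [seq opp e | e <- e1 :: s].

Definition sss_face (z : dart m + bool) : dart m + bool :=
  match z with
  | inl x => if face x == c then inr true
             else if face x == c' then inr false
             else inl (face x)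
  | inr true => inl c
  | inr false => inl c'
  end.

Definition sss_opp (z : dart m + bool) : dart m + bool :=
  match z with
  | inl x =>
      if x \in lights then
        if index x lights is i.+1 then inl (nth x darks i) else inr true
      else if x \in darks then
        if (index x darks).+1 < size lights
        then inl (nth x lights (index x darks).+1) else inr false
      else inl (opp x)
  | inr true => inl e1
  | inr false => inl (opp (last e1 s))
  end.

Definition sss_dark (z : dart m + bool) : bool :=
  if z is inl x then dark x else false.

Definition slit_slide_sew : premap :=
  @Premap (dart m + bool)%type sss_face sss_opp sss_dark.

End SlitSlideSew.

(* Removal of the edges whose sides do not satisfy [P]: the contours skip the
   removed darts. The dart [z0] only serves as a default value. *)
Section Restrict.
Variables (m : premap) (P : pred (dart m)) (z0 : {x : dart m | P x}).

Definition next_kept (x : dart m) : {x : dart m | P x} :=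
  insubd z0 (head x [seq y <- orbit (@face m) (face x) | P y]).

Definition restrict : premap :=
  @Premap {x : dart m | P x}
    (fun x => next_kept (val x))
    (fun x => insubd z0 (opp (val x)))
    (fun x => dark (val x)).

End Restrict.

Record quadruple := Quadruple {
  q_or : orientation;
  q_map : premap;
  q_corner : dart q_map;
  q_edge : dart q_map
}.

Definition in_H (p : nat) (q : quadruple) : Prop :=
  [/\ phypermap (q_map q) p,
      is_light_corner (q_corner q),
      is_edge (q_edge q)
    & leaving (q_or q) (q_corner q) (q_edge q)].

(* Orientation-preserving homeomorphism. *)
Definition isomorphic (q q' : quadruple) : Prop :=
  q_or q = q_or q' /\
  exists f : dart (q_map q) -> dart (q_map q'),
    [/\ bijective f,
        forall x, f (face x) = face (f x),
        forall x, f (opp x) = opp (f x),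
        forall x, dark (f x) = dark x
      & f (q_corner q) = q_corner q' /\ f (q_edge q) = q_edge q'].

(* The darts remaining when the dangling edge [l_1] is removed. *)
Definition kept (m : premap) (l1 : dart m) : pred (dart m + bool) :=
  fun z => z \notin [:: inl l1; inr true].

Lemma kept_new (m : premap) (l1 : dart m) : kept l1 (inr false).
Proof. by []. Qed.

(* In the result, [inr false] is the light side of [d_k], so that it represents
   the edge given by [d_k]; the new corner is the one before the first dart
   following the removed dangling edge. *)
Definition Phi (q : quadruple) : quadruple :=
  let O := reverse (q_or q) in
  let c := q_corner q in
  let ce := corner_preceding O (q_edge q) in
  match lightest_geodesic O ce c with
  | [::] => q (* does not occur for [q] in H *)
  | e1 :: s =>
      let m1 := slit_slide_sew ce c e1 s in
      let z0 : {z : dart m1 | kept e1 z} := exist _ (inr false) (kept_new e1) in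
      @Quadruple O (restrict z0) (@next_kept m1 (kept e1) z0 (inr true)) z0
  end.

(* Main.v *)
Require Import Defs.
From mathcomp Require Import all_boot perm.

(* Calling [e] the new dart [inr false], the operation acts on the darts of the
   initial map: [e] is moved in front of [c] in the contours, and the dark sides
   of the edges e_0 = e, ..., e_(k-1) of the geodesic are cyclically shifted. The
   vertex v_i of the geodesic is cut into a light part and a dark part, and the
   dark part of v_i is glued to the light part of v_(i+1) into a vertex w_i.
   Consider the potential k - d(x, c) of a vertex x, with the value i at w_i. The
   geodesic being the lightest one, no edge leaving a light part gets closer to
   [c]; hence the potential increases by at most 1 along every edge of the new
   map, and does not increase along an edge that ends in a light part. It follows
   that w_0, ..., w_k is a geodesic of the new map and that, read backwards, it
   is the lightest one, so that the operation undoes itself. Planarity: gluing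
   back induces a surjection from the vertices of the new map to those of the
   initial one, and likewise for faces, hence equality by involutivity. *)

Set Implicit Arguments.
Unset Strict Implicit.
Unset Printing Implicit Defensive.

(** * Orbits *)

(** The light part of v_(i+1) is described combinatorially, as an interval of the orbit of [turn],
    from [T i] to [S i.+1]; distances to [c] tell the v_i apart. The map [psi] sends the half-edges
    of w_i to v_i. It is defined before w_i is known to be a vertex: checking that it is constant
    along the vertices of the new map serves both the potential and the count of vertices. That
    check is the bulk of the case analysis. It is done once per orientation, because a dart lies at
    the origin of its edge for light-left and at its end for light-right, so that the degenerate
    positions differ: [e = c] can only happen for light-right, [face e = c] only for light-left. The
    potential provides lower bounds on the new distances without any description of the new
    geodesics. The study of geodesics rests on [hyper] alone, a property that sliding preserves, so
    it applies again to the slid map. As the darts stay the same, sliding twice gives back [face]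
    and [opp] as functions, and isomorphisms are only needed to compare with [Phi]. *)

Lemma fconnect_homo (T : finType) (g h : T -> T) (r : T -> T) x y :
    (forall a, fconnect g (r a) (r (h a))) ->
  fconnect h x y -> fconnect g (r x) (r y).
Proof.
move=> gr /iter_findex <-; elim: (findex _ _ _) => [|n IH]; first exact: connect0.
by apply: connect_trans IH _; rewrite iterS.
Qed.

Section FiniteOrbits.
Variables (T : finType) (f : T -> T).
Hypothesis f_inj : injective f.

(** If [n] reached the order of the orbit, removing a full turn would give an earlier point
    satisfying [P]. *)
Lemma filter_orbit (P : pred T) x n :
    P (iter n f x) -> (forall j, j < n -> ~~ P (iter j f x)) ->
  exists r, [seq y <- orbit f x | P y] = iter n f x :: r.
Proof.
move=> Pn Pj.
have ltn : n < order f x.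
  rewrite ltnNge; apply/negP=> le_on.
  have := Pj (n - order f x); rewrite ltn_subrL order_gt0 (leq_trans (order_gt0 f x) le_on).
  move/(_ isT)/negP; apply.
  suff -> : iter (n - order f x) f x = iter n f x by [].
  by rewrite -{2}(subnK le_on) iterD (iter_order f_inj).
exists [seq y <- traject f (iter n.+1 f x) (order f x - n.+1) | P y].
rewrite /orbit -{1}(subnKC ltn) trajectD trajectSr filter_cat filter_rcons Pn.
rewrite (_ : [seq y <- traject f x n | P y] = [::]) //.
apply/eqP; rewrite -(negbK (_ == _)) -has_filter; apply/hasPn=> y /trajectP[j ltj ->].
exact: Pj.
Qed.

Lemma findex_succ x y :
  fconnect f x y -> f y != x -> findex f x (f y) = (findex f x y).+1.
Proof.
move=> xy fyx; rewrite -{1}(iter_findex xy) -iterS findex_iter //.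
have := findex_max xy; rewrite leq_eqVlt => /orP[/eqP eq_o|//].
by move: fyx; rewrite -{1}(iter_findex xy) -iterS eq_o (iter_order f_inj) eqxx.
Qed.

Lemma findex_last x y :
  fconnect f x y -> f y = x -> (findex f x y).+1 = order f x.
Proof.
move=> xy fyx; have := findex_max xy; rewrite leq_eqVlt => /orP[/eqP //|lt].
have := findex_iter lt; rewrite iterS (iter_findex xy) fyx findex0.
by [].
Qed.

Lemma findex_inj x y z :
  fconnect f x y -> fconnect f x z -> findex f x y = findex f x z -> y = z.
Proof. by move=> xy xz eq; rewrite -(iter_findex xy) eq iter_findex. Qed.

End FiniteOrbits.

(* [h] induces a surjection from the orbits of [g] to those of [f]. *)
Lemma fcard_leq (T U : finType) (f : T -> T) (g : U -> U) (h : U -> T) :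
    injective g ->
    (forall x, h (g x) = h x) -> (forall x, exists y, h y = froot f x) ->
  fcard f T <= fcard g U.
Proof.
move=> g_inj hg hf.
have hr x : h (froot g x) = h x.
  have /iter_findex <- : fconnect g x (froot g x) by apply: connect_root.
  by elim: (findex _ _ _) => //= n <-.
rewrite /n_comp_mem.
apply: (@leq_trans #|[set h x | x in [set x | froots g x]]|).
  apply: subset_leq_card; apply/subsetP=> x; rewrite !inE /= andbT => /eqP rx.
  have [y hy] := hf x; apply/imsetP; exists (froot g y).
    by rewrite inE (roots_root (fconnect_sym g_inj)).
  by rewrite hr hy rx.
apply: leq_trans (leq_imset_card _ _) _; rewrite cardsE.
by apply: subset_leq_card; apply/subsetP=> x rx; rewrite inE /= andbT.
Qed.

Arguments face {p} _.
Arguments opp {p} _.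
Arguments node {m} _.
Arguments src O {m} _.
Arguments tgt O {m} _.
Arguments turn O {m} _.
Arguments edge_from O {m} _.

Lemma reverseK : involutive reverse. Proof. by case. Qed.

(** Off the dangling darts, all orbits of [opp] have two elements; numbers of edges are thus
    compared by counting darts. *)
Lemma fcard_opp (m : premap) : involutive (@opp m) ->
  fcard (@opp m) [predC @dangling m] * 2 = #|[predC @dangling m]|.
Proof.
move=> oK; apply: fcard_order_set.
- exact: inv_inj.
- apply/subsetP=> x; rewrite !inE => nd; apply/eqP.
  have -> : order opp x = #|[set x; opp x]|; last by rewrite cards2 eq_sym nd.
  apply: eq_card => y; rewrite !inE; apply/idP/idP; last first.
    by case/orP=> /eqP->; [apply: connect0 | apply: fconnect1].
  move/iter_findex <-; elim: (findex _ _ _) => [|n]; first by rewrite eqxx.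
  by rewrite iterS => /orP[]/eqP->; rewrite ?oK eqxx ?orbT.
by move=> x y /eqP <-; rewrite !inE -!topredE /= /dangling oK eq_sym.
Qed.

(** * Distances and lightest geodesics *)

Section Basics.
Variable m : premap.
Hypotheses (face_inj : injective (@face m)) (oppK : involutive (@opp m)).
Implicit Types (O : orientation) (a b x y z u v w c e h : dart m) (s : seq (dart m)).

Lemma opp_inj : injective (@opp m). Proof. exact: inv_inj. Qed.

Lemma node_inj : injective (@node m).
Proof. by move=> x y /face_inj /opp_inj. Qed.

Lemma same_vertex_refl x : same_vertex x x. Proof. exact: connect0. Qed.

Lemma same_vertex_sym x y : same_vertex x y = same_vertex y x.
Proof. exact: (fconnect_sym node_inj). Qed.

Lemma same_vertex_trans y x z :
  same_vertex x y -> same_vertex y z -> same_vertex x z.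
Proof. exact: connect_trans. Qed.

Lemma same_vertexl x y z : same_vertex x y -> same_vertex x z = same_vertex y z.
Proof. by move=> xy; apply: (same_connect (fconnect_sym node_inj) xy). Qed.

Lemma same_node x : same_vertex x (node x).
Proof. exact: fconnect1. Qed.

Lemma same_face_opp y : same_vertex (opp y) (face y).
Proof. by have := same_node (opp y); rewrite /node oppK. Qed.

Lemma face_finv x : face (finv face x) = x.
Proof. exact: f_finv. Qed.

Lemma turnK O : cancel (@turn O m) (turn (reverse O)).
Proof.
case: O => x; rewrite /turn /node /=; first by rewrite finv_f // oppK.
by rewrite oppK face_finv.
Qed.

Lemma turn_inj O : injective (@turn O m).
Proof. exact: can_inj (turnK O). Qed.

Lemma turn_reverseK O : cancel (@turn (reverse O) m) (turn O).
Proof. by have := turnK (reverse O); rewrite reverseK. Qed.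

Lemma same_turn O x : same_vertex x (turn O x).
Proof.
have nodeE : forall y, turn LightLeft y = node y by [].
case: O; first by rewrite nodeE same_node.
by rewrite same_vertex_sym -{2}(turn_reverseK LightLeft x) nodeE same_node.
Qed.

Lemma fconnect_turn O x y : fconnect (turn O) x y = same_vertex x y.
Proof.
have sub O' a b : fconnect (turn O') a b -> same_vertex a b.
  move/iter_findex <-; elim: (findex _ _ _) => [|n IH]; first exact: connect0.
  by apply: same_vertex_trans IH _; rewrite iterS same_turn.
apply/idP/idP; first exact: sub.
case: O; first by [].
move/iter_findex <-; elim: (findex _ _ _) => [|n IH]; first exact: connect0.
apply: connect_trans IH _; rewrite iterS (fconnect_sym (@turn_inj _)).
by rewrite -{2}(turnK LightLeft (iter n _ x)); apply: fconnect1.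
Qed.

Lemma iter_turn O n x : same_vertex x (iter n (turn O) x).
Proof. by rewrite -(fconnect_turn O) fconnect_iter. Qed.

Lemma iter_turnK O n x :
  iter n (turn (reverse O)) (iter n (turn O) x) = x.
Proof. by elim: n => //= n IH; rewrite -iterS iterSr turnK IH. Qed.

Lemma src_reverse O e : src (reverse O) e = tgt O e. Proof. by case: O. Qed.
Lemma tgt_reverse O e : tgt (reverse O) e = src O e. Proof. by case: O. Qed.

Lemma srcK O : cancel (@src O m) (edge_from O).
Proof. by case: O => //= x; rewrite oppK. Qed.

Lemma edge_fromK O : cancel (@edge_from O m) (src O).
Proof. by case: O => //= x; rewrite oppK. Qed.

(** Starting from the corner preceding [e], the first half-edge met is that of [e]: if [e] is a
    candidate, the lightest geodesic begins with it. *)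
Lemma turn_corner_start O e :
  turn O (corner_start O (corner_preceding O e)) = src O e.
Proof. by case: O => /=; rewrite /node ?oppK ?face_finv ?finv_f. Qed.

Lemma same_corner_start O c : same_vertex c (corner_start O c).
Proof.
case: O => /=; last exact: connect0.
by rewrite same_vertex_sym -{2}(face_finv c) same_face_opp.
Qed.

Lemma same_corner_preceding O e : same_vertex (corner_preceding O e) (src O e).
Proof.
case: O => /=; first exact: connect0.
by rewrite same_vertex_sym same_face_opp.
Qed.

Lemma is_pathl O u u' s w : same_vertex u u' -> is_path O u s w = is_path O u' s w.
Proof. by move=> uu'; case: s => [|e s] /=; rewrite (same_vertexl _ uu'). Qed.

Lemma is_pathr O u s w w' : same_vertex w w' -> is_path O u s w = is_path O u s w'.
Proof.
move=> ww'; elim: s u => [|e s IH] u /=; last by rewrite IH.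
by rewrite !(same_vertex_sym u) (same_vertexl _ ww').
Qed.

Lemma is_path_cat O u s1 v s2 w :
  is_path O u s1 v -> is_path O v s2 w -> is_path O u (s1 ++ s2) w.
Proof.
elim: s1 u => [|e s1 IH] u /=; first by move=> uv; rewrite (is_pathl _ _ _ uv).
by case/and3P=> -> -> /IH H /H.
Qed.

Lemma is_path_rev O u s w : is_path O u s w -> is_path (reverse O) w (rev s) u.
Proof.
elim: s u => [|e s IH] u /=; first by rewrite same_vertex_sym.
case/and3P=> ee ue /IH p; rewrite rev_cons -cats1; apply: is_path_cat p _.
by rewrite /= ee src_reverse tgt_reverse same_vertex_refl same_vertex_sym.
Qed.

Lemma dist_leq_card O u w : dist O u w <= #|dart m|.
Proof. by rewrite -[leqRHS](size_iota 0) find_size. Qed.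

(** A path becomes a walk on darts, each vertex being represented by the half-edge through which it
    is reached; without repetition, such a walk visits at most [#|dart m|] darts, including the
    starting one. *)
Lemma is_path_short O u s w :
  is_path O u s w -> exists2 s', size s' < #|dart m| & is_path O u s' w.
Proof.
pose S := [rel a b : dart m |
  [exists e, [&& is_edge e, same_vertex a (src O e) & b == tgt O e]]].
move=> us.
have [p Sp lp] : exists2 p, path S u p & same_vertex (last u p) w.
  elim: s u us => [|e s IH] u /=; first by exists [::].
  case/and3P=> ee ue /IH[p Sp lp]; exists (tgt O e :: p) => //=.
  by rewrite Sp andbT; apply/existsP; exists e; rewrite ee ue eqxx.
case/shortenP: Sp lp => p' Sp' Up' _ lp'.
have szp : size p' < #|dart m| by have := max_card (mem (u :: p')); rewrite (card_uniqP Up').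
suff [s' szs us'] : exists2 s', size s' = size p' & is_path O u s' w.
  by exists s'; rewrite ?szs.
elim: p' u Sp' lp' {us szp Up' p} => [|b p' IH] u /=; first by exists [::].
case/andP=> /existsP[e /and3P[ee ue /eqP->]] /IH{}IH /IH[s' szs ps'].
by exists (e :: s'); rewrite /= ?szs // ee ue.
Qed.

Lemma dist_leq O u s w : is_path O u s w -> dist O u w <= size s.
Proof.
move=> us; case: (leqP #|dart m| (size s)) => [|lt].
  by apply: leq_trans; apply: dist_leq_card.
rewrite leqNgt; apply/negP=> /(before_find 0).
by rewrite nth_iota // add0n => /existsP[]; exists (in_tuple s).
Qed.

Lemma dist_lt_card O u s w : is_path O u s w -> dist O u w < #|dart m|.
Proof. by case/is_path_short=> s' lt /dist_leq le; apply: leq_ltn_trans le lt. Qed.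

Lemma dist_path O u w :
  dist O u w < #|dart m| -> exists2 s, size s = dist O u w & is_path O u s w.
Proof.
move=> lt; have lt' := lt; rewrite -[ltnRHS](size_iota 0) -has_find in lt'.
have := nth_find 0 lt'; rewrite nth_iota // add0n => /existsP[s ps].
by exists s => //; rewrite size_tuple.
Qed.

Lemma distl O u u' w : same_vertex u u' -> dist O u w = dist O u' w.
Proof.
by move=> uu'; apply: eq_find => n; apply: eq_existsb => s; apply: is_pathl.
Qed.

Lemma distr O u w w' : same_vertex w w' -> dist O u w = dist O u w'.
Proof.
by move=> ww'; apply: eq_find => n; apply: eq_existsb => s; apply: is_pathr.
Qed.

Lemma dist0P O u w : reflect (same_vertex u w) (dist O u w == 0).
Proof.
apply: (iffP eqP) => [d0|uw].
  have [|s /eqP] := @dist_path O u w; last by rewrite d0 size_eq0 => /eqP->.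
  by rewrite d0; apply/card_gt0P; exists u.
by apply/eqP; rewrite -leqn0; apply: (@dist_leq O u [::] w).
Qed.

Lemma dist_edge O e w : is_edge e -> dist O (src O e) w <= (dist O (tgt O e) w).+1.
Proof.
move=> ee; have [/dist_path[s <- ps]|ge] := ltnP (dist O (tgt O e) w) #|dart m|.
  by apply: (@dist_leq O _ (e :: s)); rewrite /= ee same_vertex_refl.
by apply: leq_trans (dist_leq_card _ _ _) _; apply: leq_trans ge _.
Qed.

Lemma dist_reverse O u w : dist (reverse O) u w = dist O w u.
Proof.
have le O' a b : dist (reverse O') a b <= dist O' b a.
  have [/dist_path[s <- ps]|ge] := ltnP (dist O' b a) #|dart m|.
    by rewrite -(size_rev s); apply: dist_leq; apply: is_path_rev.
  exact: leq_trans (dist_leq_card _ _ _) ge.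
by apply/eqP; rewrite eqn_leq le /= -{1}(reverseK O) le.
Qed.

Definition candidate O h w e := is_edge e && ((dist O (tgt O e) w).+1 == dist O h w).

Definition first_candidate O h w e :=
  exists2 n, iter n.+1 (turn O) h = src O e &
    forall j, j < n -> ~~ candidate O h w (edge_from O (iter j.+1 (turn O) h)).

(** A specification of [lightest_rec] without a bound on the number of steps: it can be checked on a
    given path, which [lightest_geodesicE] then identifies with the computed one. *)
Fixpoint is_lightest O h w s : Prop :=
  if s is e :: s' then
    [/\ ~~ same_vertex h w, candidate O h w e, first_candidate O h w e
      & is_lightest O (tgt O e) w s']
  else same_vertex h w.

Lemma first_candidateP O h w e :
    candidate O h w e -> first_candidate O h w e ->
  exists r, lightest_candidates O h w = e :: r.
Proof.
move=> ce [n hn lt_n]; rewrite /lightest_candidates filter_map.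
pose P := preim (edge_from O) (candidate O h w).
have [||r ->] := @filter_orbit _ _ (@turn_inj O) P (turn O h) n.
- by rewrite /= -iterSr hn srcK.
- by move=> j /lt_n; rewrite /= -iterSr.
by rewrite /= -iterSr hn srcK; exists (map (edge_from O) r).
Qed.

Lemma is_lightest_rec O n h w s :
  is_lightest O h w s -> size s <= n -> lightest_rec O n h w = s.
Proof.
elim: s n h => [|e s IH] [|n] h //=; first by move=> ->.
case=> /negbTE-> ce fe ls szs.
by have [r ->] := first_candidateP ce fe; rewrite IH.
Qed.

Lemma lightest_recP O n h w :
    dist O h w < #|dart m| -> dist O h w <= n ->
  is_lightest O h w (lightest_rec O n h w).
Proof.
elim: n h => [|n IH] h lt le /=; first by apply/(dist0P O); rewrite -leqn0.
case: ifPn => // nhw.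
have [s szs ps] := dist_path lt.
case: s szs ps => [|e s] /= szs; first by rewrite (negbTE nhw).
case/and3P=> ee he ps.
(* The first edge of a shortest path is a candidate, so the search succeeds. *)
have c0 : candidate O h w e.
  rewrite /candidate ee eqn_leq -{1}szs ltnS (dist_leq ps).
  by rewrite (distl _ _ he) dist_edge.
pose Q j := candidate O h w (edge_from O (iter j (turn O) (turn O h))).
have exQ : exists j, Q j.
  exists (findex (turn O) (turn O h) (src O e)); rewrite /Q iter_findex ?srcK //.
  by rewrite fconnect_turn -(same_vertexl _ (same_turn O h)).
case: (ex_minnP exQ) => j Qj minj; rewrite /Q in Qj; set e' := edge_from _ _ in Qj.
have Fe' : first_candidate O h w e'.
  exists j => [|i lti]; first by rewrite edge_fromK iterSr.
  by rewrite iterSr; apply/negP=> /minj; rewrite leqNgt lti.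
have [r ->] := first_candidateP Qj Fe'; split=> //.
have /andP[_ /eqP d'] := Qj.
by apply: IH; [apply: leq_trans lt; rewrite -d' | rewrite -ltnS d'].
Qed.

Lemma size_is_lightest O h w s : is_lightest O h w s -> size s = dist O h w.
Proof.
elim: s h => [|e s IH] h /=; first by move/(dist0P O)/eqP.
by case=> _ /andP[_ /eqP <-] _ /IH->.
Qed.

Lemma lightest_geodesicP O c w :
    dist O c w < #|dart m| ->
  is_lightest O (corner_start O c) w (lightest_geodesic O c w).
Proof.
rewrite (distl _ _ (same_corner_start O c)) => lt.
by apply: lightest_recP => //; apply: dist_leq_card.
Qed.

Lemma lightest_geodesicE O c w s :
  is_lightest O (corner_start O c) w s -> lightest_geodesic O c w = s.
Proof.
move=> ls; apply: is_lightest_rec => //.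
by rewrite (size_is_lightest ls) dist_leq_card.
Qed.

End Basics.

(** * Sliding along a lightest geodesic *)

Section Slide.
Variables (m : premap) (e c : dart m) (ls : seq (dart m)).

(** The inner transposition cuts [e] out of its contour, leaving it as a fixed point, and the outer
    one inserts it before [c]. For [e = c] the outer one would be trivial, whereas moving [e] in
    front of itself must change nothing. *)
Definition slide_face x :=
  if e == c then face x else tperm e c (tperm e (face e) (face x)).

Definition slide_opp x :=
  if x \in ls then opp (prev ls x)
  else if opp x \in ls then next ls (opp x) else opp x.

Definition slide := @Premap (dart m) slide_face slide_opp (@dark m).

(** The removed dangling edge hangs in the corner preceding [e], which is that of [e] for light-left
    and of [face e] for light-right. After the removal, the next dart of the contour is [face e],
    unless [e] has just been inserted before it, which happens for light-left when [face e = c]. *)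
Definition slide_corner O :=
  if O is LightLeft then if face e == c then e else face e else face e.

End Slide.

(** The local part of the definition of a hypermap, which is what the study of geodesics rests on.
    As sliding preserves it, the lemmas below can be applied to the slid map too. *)
Record hyper (m : premap) : Prop := Hyper {
  hyper_face : injective (@face m);
  hyper_opp : involutive (@opp m);
  hyper_dark_face : forall x : dart m, dark (face x) = dark x;
  hyper_dark_opp : forall x : dart m, ~~ dangling x -> dark (opp x) = ~~ dark x;
  hyper_dark : forall x : dart m, dark x -> ~~ dangling x;
  hyper_light : forall x : dart m, ~~ dark x ->
    exists2 y, fconnect face x y & dangling y
}.

Section LightestNth.
Variables (m : premap) (O : orientation).

Lemma is_lightest_nth (h w d : dart m) s i :
    is_lightest O h w s -> i < size s ->
  let hi := nth d (h :: map (tgt O) s) i in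
  [/\ dist O hi w = size s - i, candidate O hi w (nth d s i)
    & first_candidate O hi w (nth d s i)].
Proof.
elim: s h i => [|e s IH] h [|i] //=.
  move=> ls _; have := size_is_lightest (ls : is_lightest O h w (e :: s)).
  by case: ls => _ ce fe ls <-.
by case=> _ ce fe /IH{}IH lti; apply: IH.
Qed.

Lemma is_lightest_last (h w : dart m) s :
  is_lightest O h w s -> same_vertex (last h (map (tgt O) s)) w.
Proof. by elim: s h => [|e s IH] h //= [_ _ _ /IH]. Qed.

End LightestNth.

Section Sliding.
Variables (m : premap) (O : orientation) (e c : dart m) (s : seq (dart m)).
Hypothesis m_hyper : hyper m.
Implicit Types x y h : dart m.
Hypothesis c_light : ~~ dark c.
Let ls := e :: s.
Let h0 := corner_start O (corner_preceding O e).
Hypothesis lightest : is_lightest O h0 c ls.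

Let face_inj := hyper_face m_hyper.
Let oppK := hyper_opp m_hyper.
Let dark_face := hyper_dark_face m_hyper.
Let k := size ls.
Let E i := nth e ls i.
Let T i := tgt O (E i).
(* [S k] plays the part of the half-edge on which the geodesic would go on when
   exiting through the corner [c]. *)
Let S i := if i < k then src O (E i) else opp (finv face c).
Let f x := dist O x c.
Let fopp := @slide_opp m ls.
Let fface := @slide_face m e c.

Local Lemma OLR : {O = LightLeft} + {O = LightRight}.
Proof. by case: O; [left | right]. Qed.

(** * Distances along the geodesic *)

Local Lemma candE i : i < k -> candidate O (nth e (h0 :: map (tgt O) ls) i) c (E i).
Proof. by move=> lt; have [] := is_lightest_nth e lightest lt. Qed.

Local Lemma headS i : i.+1 < k -> nth e (h0 :: map (tgt O) ls) i.+1 = T i.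
Proof. by move=> lt; rewrite [LHS](nth_map e) // ltnW. Qed.

Local Lemma edgeE i : i < k -> is_edge (E i).
Proof. by move=> /candE/andP[]. Qed.

Local Lemma lightE i : i < k -> ~~ dark (E i).
Proof. by move=> /edgeE/andP[]. Qed.

Local Lemma ndE i : i < k -> ~~ dangling (E i).
Proof. by move=> /edgeE/andP[]. Qed.

Local Lemma darkD i : i < k -> dark (opp (E i)).
Proof. by move=> lt; rewrite hyper_dark_opp ?ndE // lightE. Qed.

Local Lemma fT i : i < k -> f (T i) = k - i.+1.
Proof.
move=> lt; have [d /andP[_ /eqP]] := is_lightest_nth e lightest lt.
by rewrite d subnS => <-.
Qed.

Local Lemma same_f x y : same_vertex x y -> f x = f y.
Proof. exact: distl. Qed.

Local Lemma fS i : i <= k -> f (S i) = k - i.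
Proof.
rewrite /S; case: ltnP => [lt _ | ge le].
  have [<- _ [n hn _]] := is_lightest_nth e lightest lt.
  by rewrite -hn; apply/esym/same_f; apply: iter_turn.
have -> : i = k by apply/eqP; rewrite eqn_leq le.
rewrite subnn; apply/eqP/dist0P => //.
by have := same_face_opp oppK (finv face c); rewrite face_finv.
Qed.

Local Lemma same_TS i : i < k -> same_vertex (T i) (S i.+1).
Proof.
move=> lt; rewrite /S; case: ltnP => [lt' | ge].
  have [_ _ [n hn _]] := is_lightest_nth e lightest lt'.
  by rewrite headS // in hn; rewrite -hn; apply: iter_turn.
have -> : i = k.-1 by apply/eqP; rewrite -eqSS eqn_leq lt ge.
have := is_lightest_last lightest; rewrite (last_nth e) size_map -/k => Tc.
apply: same_vertex_trans (_ : same_vertex _ c) _.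
  by rewrite /T /E; move: Tc; rewrite /= -(nth_map e e (tgt O) (_ : size s < size ls)).
rewrite same_vertex_sym //.
by have := same_face_opp oppK (finv face c); rewrite face_finv.
Qed.

(** The origins of the edges lie at distinct distances from [c]. *)
Local Lemma E_inj i j : i < k -> j < k -> E i = E j -> i = j.
Proof.
move=> lti ltj /(congr1 (src O)) eqE.
have Si : S i = src O (E i) by rewrite /S lti.
have Sj : S j = src O (E j) by rewrite /S ltj.
have := fS (ltnW lti); rewrite Si eqE -Sj fS ?(ltnW ltj) // => eqk.
by rewrite -(subKn (ltnW lti)) -eqk subKn // ltnW.
Qed.

Local Lemma uniq_ls : uniq ls.
Proof.
apply/(uniqP e) => i j; rewrite !inE => lti ltj; exact: E_inj.
Qed.

Local Lemma E_in i : i < k -> E i \in ls.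
Proof. exact: mem_nth. Qed.

Local Lemma inE_ls x : x \in ls -> exists2 i, i < k & x = E i.
Proof. by move=> xls; exists (index x ls); rewrite ?index_mem // /E nth_index. Qed.

Local Lemma ls_light x : x \in ls -> ~~ dark x.
Proof. by case/inE_ls=> i lt ->; apply: lightE. Qed.

Local Lemma D_notin i : i < k -> opp (E i) \notin ls.
Proof. by move=> lt; apply/negP=> /ls_light; rewrite darkD. Qed.

(** * The shift of the dark sides *)

Local Lemma oppE0 : fopp e = opp (E k.-1).
Proof.
rewrite /fopp /slide_opp mem_head prev_nth mem_head /= memNindex //.
by have /andP[] := uniq_ls.
Qed.

Local Lemma oppES i : i.+1 < k -> fopp (E i.+1) = opp (E i).
Proof.
move=> lt; rewrite /fopp /slide_opp E_in // prev_nth E_in // /E /= index_uniq //.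
by have /andP[] := uniq_ls.
Qed.

Local Lemma oppD i : i.+1 < k -> fopp (opp (E i)) = E i.+1.
Proof.
move=> lt; have lt' := ltnW lt.
rewrite /fopp /slide_opp (negbTE (D_notin _)) // oppK E_in //.
by rewrite next_nth E_in // index_uniq ?uniq_ls.
Qed.

Local Lemma oppDl : fopp (opp (E k.-1)) = e.
Proof.
rewrite /fopp /slide_opp (negbTE (D_notin _)) // oppK E_in // next_nth E_in //.
by rewrite index_uniq ?uniq_ls //= nth_default.
Qed.

Local Lemma oppN x : x \notin ls -> opp x \notin ls -> fopp x = opp x.
Proof. by rewrite /fopp /slide_opp => /negbTE-> /negbTE->. Qed.

(* Turning crosses the corner [before h], the half-edge [h], then the corner
   [after h]. *)
Let after (h : dart m) := if O is LightLeft then node h else h.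
Let before (h : dart m) := if O is LightLeft then h else node h.

Local Lemma cs_after h : corner_start O (after h) = h.
Proof. by rewrite /after; case: O => //=; rewrite finv_f // oppK. Qed.

Local Lemma turn_before h : turn O (corner_start O (before h)) = h.
Proof.
by rewrite /before; case: O => /=; rewrite /node ?oppK ?face_finv ?finv_f ?oppK.
Qed.

(* The corner [x] is in the light part of the end of [E i], between [T i] and
   [S i.+1]; sliding moves it to the vertex of [S i]. *)
Let lam i (x : dart m) :=
  fconnect (turn O) (T i) (corner_start O x) &&
  (findex (turn O) (T i) (corner_start O x) < findex (turn O) (T i) (S i.+1)).

Local Lemma same_cs x : same_vertex x (corner_start O x).
Proof. exact: same_corner_start. Qed.

Local Lemma lam_same i x : lam i x -> same_vertex (T i) x.
Proof.
case/andP; rewrite fconnect_turn // => + _ => H.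
by apply: same_vertex_trans H _; rewrite same_vertex_sym // same_cs.
Qed.

Local Lemma lam_f i x : i < k -> lam i x -> f x = k - i.+1.
Proof. by move=> lt /lam_same/same_f <-; apply: fT. Qed.

(** The light parts lie at vertices whose distances to [c] are distinct. *)
Local Lemma lam_inj i j x : i < k -> j < k -> lam i x -> lam j x -> i = j.
Proof.
move=> lti ltj /(lam_f lti) fi /(lam_f ltj); rewrite fi => eq.
by apply: succn_inj; rewrite -(subKn lti) eq subKn.
Qed.

(** * Corners of the light parts *)

Local Lemma lam_after i h :
  lam i (after h) = same_vertex (T i) h &&
   (findex (turn O) (T i) h < findex (turn O) (T i) (S i.+1)).
Proof. by rewrite /lam cs_after fconnect_turn. Qed.

(** The corner before [h] has the position of [h] minus one, counted from [T i]. The exception is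
    the corner before [T i], which closes the turn: its position is the largest one, so it is not
    below that of [S i.+1]. *)
Local Lemma lam_before i h : i < k ->
  lam i (before h) = [&& same_vertex (T i) h, h != T i &
   findex (turn O) (T i) h <= findex (turn O) (T i) (S i.+1)].
Proof.
move=> lt; rewrite /lam; set g := corner_start _ _.
have tg : turn O g = h by exact: turn_before.
have -> : fconnect (turn O) (T i) g = same_vertex (T i) h.
  rewrite fconnect_turn // !(same_vertex_sym face_inj oppK (T i)).
  by apply: same_vertexl => //; rewrite -tg; apply: same_turn.
case: (boolP (same_vertex _ _)) => //= sTh.
have cTg : fconnect (turn O) (T i) g.
  rewrite fconnect_turn //; apply: same_vertex_trans sTh _.
  by rewrite same_vertex_sym // -tg same_turn.
have cTS : fconnect (turn O) (T i) (S i.+1) by rewrite fconnect_turn // same_TS.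
case: eqP => [hT | /eqP nhT] /=.
  have lastg := findex_last cTg (etrans tg hT).
  by apply/negbTE; rewrite -leqNgt -ltnS lastg; apply: findex_max.
by rewrite -[h in RHS]tg findex_succ ?tg //; apply: turn_inj.
Qed.

Local Lemma lam_near i h :
  i < k -> h != T i -> h != S i.+1 -> lam i (node h) = lam i h.
Proof.
move=> lt hT hS; suff : lam i (after h) = lam i (before h).
  by rewrite /after /before; case: O => ->.
rewrite lam_after lam_before // hT /=; case: (boolP (same_vertex _ _)) => //= sTh.
rewrite [in RHS]leq_eqVlt; case: eqP => //= /findex_inj eq.
by case/eqP: hS; apply: eq; rewrite fconnect_turn // same_TS.
Qed.

Local Lemma lam_after_T i : i < k -> lam i (after (T i)) = (S i.+1 != T i).
Proof.
move=> lt; rewrite lam_after same_vertex_refl findex0 lt0n /=; congr (~~ _).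
apply/eqP/eqP => [eq|->]; last by rewrite findex0.
have cTS : fconnect (turn O) (T i) (S i.+1) by rewrite fconnect_turn // same_TS.
by rewrite -(iter_findex cTS) eq.
Qed.

Local Lemma lam_before_T i : i < k -> lam i (before (T i)) = false.
Proof. by move=> lt; rewrite lam_before // eqxx andbF. Qed.

Local Lemma lam_after_S i : i < k -> lam i (after (S i.+1)) = false.
Proof. by move=> lt; rewrite lam_after ltnn andbF. Qed.

Local Lemma lam_before_S i : i < k -> lam i (before (S i.+1)) = (S i.+1 != T i).
Proof. by move=> lt; rewrite lam_before // same_TS // leqnn andbT. Qed.

(* A vertex of the initial map whose dark part is at [x] in the slid map. *)
Let psi (x : dart m) := froot node
  (if x == e then S (if O is LightLeft then k.-1 else k)
   else if [pick i : 'I_k | lam i x] is Some i then S i else x).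

(** * Vertices of the slid map *)

Local Lemma froot_same x y : same_vertex x y -> froot node x = froot node y.
Proof. by move/(rootP (fconnect_sym (node_inj face_inj oppK))). Qed.

(** In the slid map, the edge [e] goes from w_(k-1) to w_k; the dart [e] is at its origin for
    light-left and at its end for light-right. *)
Local Lemma psi_e : psi e = froot node (S (if O is LightLeft then k.-1 else k)).
Proof. by rewrite /psi eqxx. Qed.

Local Lemma psi_lam i x : x != e -> i < k -> lam i x -> psi x = froot node (S i).
Proof.
rewrite /psi => /negbTE-> lt lx; case: pickP => [j lj|/(_ (Ordinal lt))/=]; last by rewrite lx.
by rewrite (lam_inj (ltn_ord j) lt lj lx).
Qed.

(** This deals with the dark part of v_j, as [psi_lam] does with light parts. The guard [0 < j]
    reflects that v_0 has no light part: no edge of the path ends there. *)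
Local Lemma psi_at j x : x != e -> j <= k -> same_vertex x (S j) ->
  (0 < j -> ~~ lam j.-1 x) -> psi x = froot node (S j).
Proof.
rewrite /psi => /negbTE-> le sx nlam; case: pickP => [i li|_]; last exact: froot_same.
have := lam_f (ltn_ord i) li; rewrite (same_f sx) fS // => eq.
have jE : j = i.+1 by rewrite -(subKn le) eq subKn.
by move: nlam; rewrite jE /= li => /(_ isT).
Qed.

Local Lemma psi_eq x y : x != e -> y != e -> same_vertex x y ->
  (forall i, i < k -> lam i x = lam i y) -> psi x = psi y.
Proof.
rewrite /psi => /negbTE-> /negbTE-> sxy eqlam.
rewrite (eq_pick (fun i : 'I_k => eqlam i (ltn_ord i))).
by case: pickP => // _; apply: froot_same.
Qed.

Local Lemma k_gt0 : 0 < k. Proof. by []. Qed.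
Local Lemma k_pred : k.-1 < k. Proof. by []. Qed.
Local Lemma k_predK : k.-1.+1 = k. Proof. by []. Qed.

Local Lemma edge_e : is_edge e. Proof. exact: (edgeE k_gt0). Qed.

(** The light face of [e] also contains the dangling half-edge of its marked corner, so its contour
    survives the removal of [e]. *)
Local Lemma face_e_neq : face e != e.
Proof.
have /andP[le nde] := edge_e; have [y ey dy] := hyper_light m_hyper le.
apply: contraNneq nde => fe; suff -> : e = y by [].
by rewrite -(iter_findex ey) iter_fix.
Qed.

Local Lemma fc0 : f c = 0.
Proof. by apply/eqP/dist0P; apply: same_vertex_refl. Qed.

Local Lemma Sk : S k = opp (finv face c).
Proof. by rewrite /S ltnn. Qed.

Local Lemma same_cS : same_vertex c (S k).
Proof.
rewrite Sk same_vertex_sym //.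
by have := same_face_opp oppK (finv face c); rewrite face_finv.
Qed.

(** Hence the corner [c] is [after (S k)], outside the light part of v_k, for light-left, but
    [before (S k)], possibly inside it, for light-right. This is consistent with the insertion of
    [e] before [c]: the dart [e] ends at w_k for light-left and at w_(k-1) for light-right. *)
Local Lemma node_Sk : node (S k) = c.
Proof. by rewrite Sk /node oppK face_finv. Qed.

Local Lemma dark_neq x : dark x -> x != e.
Proof. by apply: contraTneq => ->; have /andP[] := edge_e. Qed.

Local Lemma ls_neq x : x \notin ls -> x != e.
Proof. by apply: contraNneq => ->; apply: mem_head. Qed.

Local Lemma Sneq y i : opp y \notin ls -> y \notin ls -> y != finv face c -> i < k ->
  opp y != S i.+1.
Proof.
move=> yn yn' yc lt; rewrite /S; case: ltnP => [lt'|_].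
  case: OLR => -> /=; first by apply: contraNneq yn => ->; apply: E_in.
  by apply: contraNneq yn' => /(opp_inj oppK)->; apply: E_in.
by apply: contra yc => /eqP/(opp_inj oppK)->.
Qed.

Local Lemma Tneq y i : opp y \notin ls -> y \notin ls -> i < k -> opp y != T i.
Proof.
move=> yn yn' lt; rewrite /T; case: OLR => -> /=.
  by apply: contraNneq yn' => /(opp_inj oppK)->; apply: E_in.
by apply: contraNneq yn => ->; apply: E_in.
Qed.

(** The two half-edges are told apart by the shades of their darts. The exception is the exit for
    light-left: if the last edge comes just before [c] in the contour, then [S k] is [T k.-1] and
    the light part of v_k is empty. *)
Local Lemma STneq i :
  i < k -> (O = LightLeft -> face (E i) != c) -> S i.+1 != T i.
Proof.
move=> lt nfc; rewrite /S /T; case: ltnP => [lt'|_]; case: OLR => OE; rewrite OE /=.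
- by apply: contraTneq (darkD lt) => <-; apply: lightE.
- by apply: contraTneq (darkD lt') => ->; apply: lightE.
- by apply: contra (nfc OE) => /eqP/(opp_inj oppK) <-; rewrite face_finv.
apply: contraNneq (ndE lt) => eqE; rewrite /dangling -eqE oppK.
case: (boolP (dangling (finv face c))) => [/eqP->//|].
move/(hyper_dark_opp m_hyper); rewrite eqE (negbTE (lightE lt)).
by rewrite -dark_face face_finv // c_light.
Qed.

Local Lemma slide_faceE y : e != c ->
  fface y = if y == e then c else
            if face y == c then e else
            if face y == e then if face e == c then e else face e else face y.
Proof.
move=> ec; rewrite /fface /slide_face (negbTE ec).
case: (eqVneq y e) => [->|ye]; first by rewrite tpermR tpermL.
have fye : face y != face e by apply: contra ye => /eqP/face_inj->.
case: (eqVneq (face y) c) => [fyc|nfyc].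
  by rewrite fyc [X in tperm e c X]tpermD ?tpermR // eq_sym -fyc.
case: (eqVneq (face y) e) => [fye'|nfye'].
  rewrite fye' tpermL; case: eqP => [->|/eqP nc]; first by rewrite tpermR.
  by apply: tpermD; rewrite eq_sym // face_e_neq.
by rewrite [X in tperm e c X]tpermD; first apply: tpermD; rewrite eq_sym.
Qed.

Local Lemma path_cases y :
  [\/ y \notin ls /\ opp y \notin ls, exists2 i, i < k & y = E i
    | exists2 i, i < k & y = opp (E i)].
Proof.
case: (boolP (y \in ls)) => [/inE_ls|yn]; first by constructor 2.
case: (boolP (opp y \in ls)) => [/inE_ls[i lt eq]|yn']; last by constructor 1.
by constructor 3; exists i => //; rewrite -eq oppK.
Qed.

Local Lemma face_notin y : dark y -> e != c -> fface y = face y.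
Proof.
move=> dy ec; rewrite slide_faceE //.
have /negbTE -> := dark_neq dy.
have dfy : dark (face y) by rewrite dark_face.
have /negbTE -> := dark_neq dfy.
by case: eqP => // fc; rewrite fc (negbTE c_light) in dfy.
Qed.

Local Lemma psi_off y : y \notin ls -> opp y \notin ls ->
  face y != e -> face y != c -> psi (face y) = psi (opp y).
Proof.
move=> yn yn' fe fc; apply: psi_eq => //; first exact: ls_neq.
  by rewrite same_vertex_sym //; apply: same_face_opp.
move=> i lt; have := lam_near lt (Tneq yn' yn lt); rewrite /node oppK; apply.
by apply: Sneq => //; apply: contra fc => /eqP->; rewrite face_finv.
Qed.

(** In the slid map, [fface y] and [fopp y] both start where the dart [y] ends, so this is the
    invariance of [psi] along vertices. The cases are: [y] off the path, [y] a light side, [y] a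
    dark side. *)
Local Lemma psi_inv_left y : O = LightLeft -> psi (fface y) = psi (fopp y).
Proof.
move=> OE.
have SE i : i < k -> S i = E i by rewrite /S OE => ->.
have TE i : T i = opp (E i) by rewrite /T OE.
have afE h : after h = node h by rewrite /after OE.
have bfE h : before h = h by rewrite /before OE.
have psie : psi e = froot node (S k.-1) by rewrite psi_e OE.
have fe : f e = k by rewrite -[e]/(E 0) -SE // fS // subn0.
have ec : e != c by apply/eqP=> eqec; move: fe; rewrite eqec fc0 => /eqP.
have fface_E i : i < k -> f (face (E i)) = k - i.+1.
  by move=> lt; rewrite -fT // TE; apply/esym/same_f/same_face_opp.
have face_neq i : i < k -> face (E i) != e.
  move=> lt; apply/eqP=> eq; have := fface_E i lt; rewrite eq fe => /eqP.
  by rewrite eqn_leq leqNgt ltn_subrL.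
have psi_T i : i < k -> psi (opp (E i)) = froot node (S i.+1).
  move=> lt; apply: psi_at => //; first exact: dark_neq (darkD lt).
    by rewrite -TE same_TS.
  by rewrite -TE -[T i]bfE lam_before_T.
have psi_fE i : i < k -> face (E i) != c -> psi (face (E i)) = froot node (S i).
  move=> lt nc; apply: psi_lam => //; first exact: face_neq.
  have -> : face (E i) = after (T i) by rewrite afE TE /node oppK.
  by rewrite lam_after_T // STneq.
case: (path_cases y) => [[yn yn']|[i lt ->]|[i lt ->]].
- rewrite slide_faceE // (negbTE (ls_neq yn)) [fopp y]oppN //.
  case: eqP => [fyc|/eqP nfyc].
    (* The dart [y] now leads to [e], which starts at w_(k-1). Its other side is [S k], and the
       corner before [S k] is the last one of the light part of v_k. *)
    rewrite psie; apply/esym; apply: psi_lam => //; first exact: ls_neq.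
    have yE : opp y = S k by rewrite Sk -fyc finv_f.
    rewrite -[opp y]bfE yE -k_predK lam_before_S // k_predK -yE.
    exact: Tneq.
  case: eqP => [fye|/eqP nfye]; last exact: psi_off.
  have -> : psi (opp y) = froot node (S 0).
    apply: psi_at => //; first exact: ls_neq.
    by apply: same_vertex_trans (same_face_opp oppK y) _; rewrite fye SE // same_vertex_refl.
  case: eqP => [fec|/eqP nfec]; last exact: (psi_fE 0).
  (* Here [e] is already in front of [c] and stays there; the distance of [face e] to [c] is both 0
     and [k - 1], so [S k.-1] is [S 0]. *)
  have := fface_E 0 k_gt0; rewrite [face _]fec fc0 => k1.
  by rewrite psie (_ : k.-1 = 0) // -subn1 -k1.
- case: i lt => [|i] lt.
    rewrite [fopp _]oppE0 slide_faceE // eqxx psi_T // k_predK.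
    apply: psi_at => //; rewrite 1?eq_sym // ?same_cS //.
    by rewrite -[c in lam _ c]node_Sk -afE -{2}k_predK lam_after_S.
  rewrite [fopp _]oppES // psi_T 1?ltnW // slide_faceE //.
  have /negbTE -> : E i.+1 != e by apply/eqP=> /(E_inj lt k_gt0).
  rewrite (negbTE (face_neq _ lt)); case: eqP => [fec|/eqP nfec]; last exact: psi_fE.
  have := fface_E _ lt; rewrite fec fc0 => /esym/eqP; rewrite subn_eq0 => le.
  by rewrite psie (_ : k.-1 = i.+1) //; apply/eqP; rewrite -eqSS k_predK eqn_leq le lt.
rewrite face_notin //; last exact: darkD.
have ltw := ltnW lt.
have -> : psi (face (opp (E i))) = froot node (S i).
  apply: psi_at => //.
  - by apply: dark_neq; rewrite dark_face darkD.
  - by rewrite SE // same_vertex_sym // same_node.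
  case: i lt {ltw} => // i lt _.
  have -> : face (opp (E i.+1)) = after (S i.+1) by rewrite SE // afE.
  by rewrite lam_after_S // ltnW.
case: (ltnP i.+1 k) => [lt'|ge].
  rewrite [fopp _]oppD //; apply/esym; apply: psi_lam => //.
    by apply/eqP=> /(E_inj lt' k_gt0).
  rewrite -SE // -[S _]bfE lam_before_S // STneq // => _.
  apply/eqP => fec; have := fface_E _ lt; rewrite fec fc0 => /esym/eqP.
  by rewrite subn_eq0 leqNgt lt'.
have -> : i = k.-1 by apply/eqP; rewrite -eqSS k_predK eqn_leq lt ge.
by rewrite [fopp _]oppDl psie.
Qed.

Local Lemma psi_inv_right y : O = LightRight -> psi (fface y) = psi (fopp y).
Proof.
move=> OE.
have SE i : i < k -> S i = opp (E i) by rewrite /S OE => ->.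
have TE i : T i = E i by rewrite /T OE.
have afE h : after h = h by rewrite /after OE.
have bfE h : before h = node h by rewrite /before OE.
have psie : psi e = froot node (S k) by rewrite psi_e OE.
have fe : f e = k.-1 by rewrite -[e]/(E 0) -TE fT // subn1.
have STn i : i < k -> S i.+1 != T i by move=> lt; apply: STneq => //; rewrite OE.
(* The dart [e] being at the end of the first edge, [e = c] forces [k = 1]. The light part then
   reduces to the corner [e], and sliding changes nothing. *)
case: (eqVneq e c) => [eqec|ec].
  have k1 : k = 1 by rewrite -k_predK -fe eqec fc0.
  have psiE x : psi x = froot node x.
    case: (eqVneq x e) => [->|xe].
      by rewrite psie; apply: froot_same; rewrite same_vertex_sym // eqec same_cS.
    rewrite /psi (negbTE xe); case: pickP => // i.
    have -> : nat_of_ord i = 0 by move: (ltn_ord i); rewrite {2}k1 ltnS leqn0 => /eqP.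
    rewrite /lam TE -[E 0]/e => /andP[cx].
    have -> : S 1 = turn O e by rewrite -k1 Sk OE /= -eqec.
    have le1 : findex (turn O) e (turn O e) <= 1.
      case: (eqVneq (turn O e) e) => [->|ne]; first by rewrite findex0.
      by rewrite findex_succ ?findex0 //; apply: turn_inj.
    move=> /leq_trans/(_ le1); rewrite ltnS leqn0 => /eqP pos0.
    by case/eqP: xe; have := iter_findex cx; rewrite pos0 OE.
  rewrite !psiE /fface /slide_face eqec eqxx; apply: froot_same.
  suff -> : fopp y = opp y by rewrite same_vertex_sym // same_face_opp.
  case: (path_cases y) => [[]|[i lt ->]|[i lt ->]]; first exact: oppN.
    by move: lt; rewrite {1}k1 ltnS leqn0 => /eqP->; rewrite [LHS]oppE0 k1.
  by move: lt; rewrite {1}k1 ltnS leqn0 => /eqP->; have := oppDl; rewrite k1 oppK.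
have fface_E i : i < k -> f (face (E i)) = k - i.
  by move=> lt; rewrite -fS 1?ltnW // SE //; apply/esym/same_f/same_face_opp.
have face_neq i : i < k -> face (E i) != c.
  move=> lt; apply/eqP=> eq; have := fface_E i lt; rewrite eq fc0 => /esym/eqP.
  by rewrite subn_eq0 leqNgt lt.
have psi_S i : i < k -> psi (opp (E i)) = froot node (S i).
  move=> lt; apply: (psi_at _ (ltnW lt)); first exact: dark_neq (darkD lt).
    by rewrite SE // same_vertex_refl.
  by case: i lt => // i lt _; rewrite -SE // -[S _]afE lam_after_S // ltnW.
have psi_fe : psi (face e) = froot node (S 0).
  apply: psi_at => //; first exact: face_e_neq.
  by rewrite SE // same_vertex_sym // same_face_opp.
case: (path_cases y) => [[yn yn']|[i lt ->]|[i lt ->]].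
- rewrite slide_faceE // (negbTE (ls_neq yn)) [fopp y]oppN //.
  case: eqP => [fyc|/eqP nfyc].
    have yE : opp y = S k by rewrite Sk -fyc finv_f.
    rewrite psie; apply/esym; apply: psi_at => //; first exact: ls_neq.
      by rewrite yE same_vertex_refl.
    by move=> _; rewrite yE -[S k]afE -{2}k_predK lam_after_S.
  case: eqP => [fye|/eqP nfye]; last exact: psi_off.
  rewrite (negbTE (face_neq 0 k_gt0)) psi_fe.
  apply/esym; apply: psi_lam => //; first exact: ls_neq.
  have <- : lam 0 (node (opp y)) = lam 0 (opp y).
    apply: lam_near => //; first exact: Tneq.
    by apply: Sneq => //; apply: contra nfyc => /eqP->; rewrite face_finv.
  have -> : node (opp y) = after (T 0) by rewrite /node oppK fye afE TE.
  by rewrite lam_after_T // STn.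
- case: i lt => [|i] lt.
    rewrite [fopp _]oppE0 slide_faceE // eqxx psi_S //.
    apply: psi_lam => //; first by rewrite eq_sym.
    by rewrite -node_Sk -bfE -{2}k_predK lam_before_S // STn.
  have lt' := ltnW lt.
  rewrite [fopp _]oppES // psi_S // slide_faceE //.
  have /negbTE -> : E i.+1 != e by apply/eqP=> /(E_inj lt k_gt0).
  rewrite (negbTE (face_neq _ lt)) (negbTE (face_neq 0 k_gt0)).
  case: eqP => [fye|/eqP nfye].
    (* The dart [e] is at distance [k.-1] from [c], so among these edges only [E 1] can be followed
       by [e] in its contour. *)
    rewrite psi_fe; have := fface_E _ lt; rewrite fye fe -subn1 => eq.
    have : i.+1 = 1 by rewrite -(subKn (ltnW lt)) -eq subKn.
    by case=> ->.
  apply: psi_lam => //.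
  have -> : face (E i.+1) = before (S i.+1) by rewrite bfE SE // /node oppK.
  by rewrite lam_before_S // STn.
rewrite face_notin //; last exact: darkD.
have -> : psi (face (opp (E i))) = froot node (S i.+1).
  apply: psi_at => //.
  - by apply: dark_neq; rewrite dark_face darkD.
  - apply: same_vertex_trans (same_TS lt); rewrite TE same_vertex_sym //.
    exact: same_node.
  move=> _; have -> : face (opp (E i)) = before (T i) by rewrite bfE TE.
  by rewrite lam_before_T.
case: (ltnP i.+1 k) => [lt'|ge].
  rewrite [fopp _]oppD //; apply/esym; apply: psi_lam => //.
    by apply/eqP=> /(E_inj lt' k_gt0).
  by rewrite -TE -[T _]afE lam_after_T // STn.
have -> : i = k.-1 by apply/eqP; rewrite -eqSS k_predK eqn_leq lt ge.
by rewrite [fopp _]oppDl psie k_predK.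
Qed.

Local Lemma psi_inv y : psi (fface y) = psi (fopp y).
Proof. by case: OLR => OE; [apply: psi_inv_left | apply: psi_inv_right]. Qed.

Let m' := slide e c ls.

(** * Shades and dangling half-edges of the slid map *)

Local Lemma slide_face_inj : injective (@face m').
Proof.
rewrite /face /= /slide_face => x y; case: eqP => _; first exact: face_inj.
by move/perm_inj/perm_inj/face_inj.
Qed.

Local Lemma slide_oppK : involutive (@opp m').
Proof.
move=> y /=; rewrite -[slide_opp ls]/fopp.
have e_last : fopp (opp (E k.-1)) = e by exact: oppDl.
have e_first : fopp e = opp (E k.-1) by exact: oppE0.
case: (path_cases y) => [[yn yn']|[[|i] lt ->]|[i lt ->]].
- by rewrite (oppN yn yn') oppN ?oppK.
- by rewrite [E 0]/= e_first.
- by rewrite oppES // oppD.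
case: (ltnP i.+1 k) => [lt'|ge]; first by rewrite oppD // oppES.
have -> : i = k.-1 by apply/eqP; rewrite -eqSS k_predK eqn_leq lt ge.
by rewrite e_last.
Qed.

Local Lemma fopp_ls x : x \in ls -> dark (fopp x).
Proof.
case/inE_ls=> [[|i] lt ->]; first by rewrite [fopp _]oppE0 darkD.
by rewrite oppES // darkD // ltnW.
Qed.

Local Lemma fopp_dark x : opp x \in ls -> fopp x \in ls /\ dark x.
Proof.
move=> oxl; have [i lt ox] := inE_ls oxl.
have xE : x = opp (E i) by rewrite -ox oppK.
split; last by rewrite xE darkD.
by rewrite /fopp /slide_opp oxl xE (negbTE (D_notin lt)) oppK mem_next E_in.
Qed.

Local Lemma slide_dangling x : @dangling m' x = dangling x.
Proof.
rewrite /dangling /= -[slide_opp ls]/fopp.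
case: (boolP (x \in ls)) => [xls|xn].
  have dx := fopp_ls xls; have [i lt xE] := inE_ls xls.
  rewrite [RHS](negbTE _); last by rewrite xE (ndE lt).
  by apply/eqP=> eq; move: dx; rewrite eq xE (negbTE (lightE lt)).
case: (boolP (opp x \in ls)) => [oxl|oxn]; last by rewrite oppN.
have [/ls_light nd dx] := fopp_dark oxl.
have /negbTE -> : opp x != x by apply: (hyper_dark m_hyper).
by apply/eqP=> eq; move: nd; rewrite eq dx.
Qed.

Local Lemma slide_is_edge x : @is_edge m' x = is_edge x.
Proof. by rewrite /is_edge slide_dangling. Qed.

Local Lemma slide_dark_face (x : dart m') : dark (face x) = dark x.
Proof.
rewrite /= -[slide_face e c]/fface.
have le : ~~ dark e by have /andP[] := edge_e.
case: (eqVneq e c) => [ec|ec]; first by rewrite /fface /slide_face ec eqxx dark_face.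
rewrite slide_faceE //; case: eqP => [->|_]; first by rewrite (negbTE le) (negbTE c_light).
rewrite -[in RHS]dark_face; case: eqP => [->|_]; first by rewrite (negbTE le) (negbTE c_light).
case: eqP => [->|//]; case: eqP => // _; by rewrite dark_face.
Qed.

Local Lemma slide_dark_opp x : ~~ @dangling m' x -> dark (@opp m' x) = ~~ dark x.
Proof.
rewrite slide_dangling /= -[slide_opp ls]/fopp => nd.
case: (boolP (x \in ls)) => [xls|xn]; first by rewrite fopp_ls // ls_light.
case: (boolP (opp x \in ls)) => [oxl|oxn].
  by have [/ls_light/negbTE-> ->] := fopp_dark oxl.
by rewrite oppN // hyper_dark_opp.
Qed.

Local Lemma psi_node (x : dart m') : psi (node x) = psi x.
Proof. by rewrite /node /= [LHS]psi_inv -[RHS]/(psi x); congr psi; apply: slide_oppK. Qed.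

Local Lemma psi_same (x y : dart m') : same_vertex x y -> psi x = psi y.
Proof.
by move/iter_findex <-; elim: (findex _ _ _) => //= n ->; rewrite psi_node.
Qed.

(** The subtraction is truncated, so everything farther than [k] from [c] gets the value 0; bounds
    on the increase along edges survive this truncation. *)
Let K x := k - f (psi x).

Local Lemma f_froot x : f (froot node x) = f x.
Proof. by apply/esym/same_f; apply: connect_root. Qed.

(* The slid path goes through [A 0], [Z 0] -> [A 1], [Z 1] -> ... -> [A k],
   where [A i] and [Z i] are half-edges at the same vertex. *)
Let E' i := if i.+1 < k then E i.+1 else e.
Let Z i : dart m' := @src O m' (E' i).
Let A i : dart m' := if i is i'.+1 then @tgt O m' (E' i') else h0.

Local Lemma fopp_E' i : i < k -> fopp (E' i) = opp (E i).
Proof.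
rewrite /E' => lt; case: ltnP => [lt'|ge]; first exact: oppES.
have -> : i = k.-1 by apply/eqP; rewrite -eqSS k_predK eqn_leq lt ge.
exact: oppE0.
Qed.

Local Lemma ZL i : O = LightLeft -> Z i = E' i. Proof. by rewrite /Z => ->. Qed.
Local Lemma ZR i : O = LightRight -> i < k -> Z i = opp (E i).
Proof. by rewrite /Z => -> lt /=; apply: fopp_E'. Qed.
Local Lemma AL i : O = LightLeft -> i < k -> A i.+1 = opp (E i).
Proof. by rewrite /A => -> lt /=; apply: fopp_E'. Qed.
Local Lemma AR i : O = LightRight -> A i.+1 = E' i. Proof. by rewrite /A => ->. Qed.

Local Lemma E'_neq i : i.+1 < k -> E i.+1 != e.
Proof. by move=> lt; apply/eqP=> /(E_inj lt k_gt0). Qed.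

Local Lemma face_E_neq_c i : O = LightLeft -> i.+1 < k -> face (E i) != c.
Proof.
move=> OE lt; apply/eqP=> fec; have := fT (ltnW lt); rewrite /T OE /=.
rewrite (same_f (same_face_opp oppK _)) fec fc0 => /esym/eqP.
by rewrite subn_eq0 leqNgt lt.
Qed.

(** The edge [E' i] goes from w_i to w_(i+1). For [i.+1 < k], its origin is read in the light part
    of v_(i+1) for light-left, where [Z i] is a light side, and in the dark part of v_i for
    light-right; [psi_A] is the symmetric statement at its end. *)
Local Lemma psi_Z i : i < k -> psi (Z i) = froot node (S i).
Proof.
move=> lt; case: OLR => OE.
  rewrite ZL // /E'; case: ltnP => [lt'|ge].
    apply: psi_lam => //; first exact: E'_neq.
    have -> : E i.+1 = before (S i.+1) by rewrite /before /S OE lt'.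
    by rewrite lam_before_S // STneq // => _; apply: face_E_neq_c.
  have -> : i = k.-1 by apply/eqP; rewrite -eqSS k_predK eqn_leq lt ge.
  by rewrite psi_e OE.
rewrite ZR //; have SE : S i = opp (E i) by rewrite /S lt OE.
apply: (psi_at _ (ltnW lt)); rewrite ?SE ?same_vertex_refl //.
  exact: dark_neq (darkD lt).
case: i lt SE => // i lt SE _; rewrite -SE.
have -> : S i.+1 = after (S i.+1) by rewrite /after OE.
by rewrite lam_after_S // ltnW.
Qed.

Local Lemma psi_A i : i < k -> psi (A i.+1) = froot node (S i.+1).
Proof.
move=> lt; case: OLR => OE.
  rewrite AL //; have TE : T i = opp (E i) by rewrite /T OE.
  apply: psi_at => //; first exact: dark_neq (darkD lt).
    by rewrite -TE same_TS.
  move=> _; rewrite -TE; have -> : T i = before (T i) by rewrite /before OE.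
  by rewrite lam_before_T.
rewrite AR // /E'; case: ltnP => [lt'|ge].
  apply: psi_lam => //; first exact: E'_neq.
  have -> : E i.+1 = after (T i.+1) by rewrite /after /T OE.
  by rewrite lam_after_T // STneq // OE.
have -> : i = k.-1 by apply/eqP; rewrite -eqSS k_predK eqn_leq lt ge.
by rewrite psi_e OE k_predK.
Qed.

Local Lemma K_S i x : i <= k -> psi x = froot node (S i) -> K x = i.
Proof. by move=> le px; rewrite /K px f_froot fS // subKn. Qed.

Local Lemma K_Z i : i < k -> K (Z i) = i.
Proof. by move=> lt; apply: K_S (ltnW lt) _; apply: psi_Z. Qed.

Local Lemma K_A i : i < k -> K (A i.+1) = i.+1.
Proof. by move=> lt; apply: K_S => //; apply: psi_A. Qed.

Local Lemma opp_notin x : is_edge x -> opp x \notin ls.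
Proof.
case/andP=> lx ndx; apply/negP=> /ls_light.
by rewrite hyper_dark_opp // lx.
Qed.

(** A half-edge either keeps its vertex or, in a light part, is moved from v_(i+1) to w_i, whose
    potential is one less. *)
Local Lemma K_leq x : x != e -> K x <= k - f x.
Proof.
rewrite /K /psi => /negbTE->; rewrite f_froot; case: pickP => // i li.
by rewrite (lam_f (ltn_ord i) li) fS 1?ltnW // !subKn // ltnW.
Qed.

Local Lemma findex_iter_leq n i : findex (turn O) (T i) (iter n (turn O) (T i)) <= n.
Proof.
case: (ltnP n (order (turn O) (T i))) => [/findex_iter->//|le].
have := @fconnect_iter _ (turn O) n (T i).
by move/findex_max/ltnW => h; apply: leq_trans h le.
Qed.

(* This is where the geodesic being the lightest one matters: an edge leaving a
   light part has been discarded by the construction of the geodesic. *)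
Local Lemma K_src x : is_edge x -> x \notin ls -> k - f (tgt O x) <= (K (src O x)).+1.
Proof.
move=> ex xn; have oxn := opp_notin ex.
have sxe : src O x != e by case: (OLR) => -> /=; apply: ls_neq.
have fx : f (src O x) <= (f (tgt O x)).+1 by apply: dist_edge.
rewrite /K /psi (negbTE sxe) f_froot.
case: pickP => [j lj|_]; last first.
  (* Outside the light parts the vertex has not moved, and the bound is the one on the initial
     distances. *)
  rewrite leq_subLR addnS -addSn; apply: leq_trans (leq_add fx (leqnn _)).
  by rewrite -leq_subLR.
have ltj := ltn_ord j; rewrite (fS (ltnW ltj)) subKn ?(ltnW ltj) //.
have fsrc := lam_f ltj lj.
(* In the last light part the potential is [k - 1], and the bound holds because the left-hand side
   is at most [k]. In the others, it remains to see that the edge does not get closer to [c]. *)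
case: (ltnP j.+1 k) => [ltSj|]; last by apply: leq_trans (leq_subr _ _).
have [_ _ [n hn ncand]] := is_lightest_nth e lightest ltSj.
rewrite headS // in hn ncand.
have SE : S j.+1 = src O (E j.+1) by rewrite /S ltSj.
have sTx : same_vertex (T j) (src O x) by apply: lam_same lj.
have posx : 0 < findex (turn O) (T j) (src O x) < findex (turn O) (T j) (S j.+1).
  have cTx : fconnect (turn O) (T j) (src O x) by rewrite fconnect_turn.
  have cTS : fconnect (turn O) (T j) (S j.+1) by rewrite fconnect_turn // same_TS.
  have pos0 : src O x != T j -> 0 < findex (turn O) (T j) (src O x).
    rewrite lt0n; apply: contra => /eqP eq0.
    by rewrite -(iter_findex cTx) eq0.
  case: (OLR) => OE.
    have sE : src O x = before (src O x) by rewrite /before OE.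
    move: lj; rewrite sE lam_before // -sE => /and3P[_ /pos0-> /=].
    rewrite leq_eqVlt => /orP[/eqP/(findex_inj cTx cTS) eq|//].
    by move: xn; rewrite SE OE /= in eq; rewrite eq E_in.
  have sE : src O x = after (src O x) by rewrite /after OE.
  move: lj; rewrite sE lam_after // -sE => /andP[_ ->]; rewrite andbT.
  apply: pos0; rewrite /T OE /=; apply: contraNneq oxn => ->; exact: E_in.
have [p0 p1] := andP posx.
(* Since [first_candidate] does not bound [n] by the length of a turn, the position of [S j.+1] is
   only known to be at most [n.+1]; this places [x] among the discarded half-edges. *)
have := @findex_iter_leq n.+1 j; rewrite hn -SE => leS.
have := ncand (findex (turn O) (T j) (src O x)).-1.
rewrite -ltnS prednK // (leq_trans p1 leS) => /(_ isT).
rewrite iter_findex ?fconnect_turn // srcK // /candidate ex /= -/(f (T j)) fT //.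
rewrite -/(f (tgt O x)) => ne; rewrite fsrc leq_eqVlt eq_sym (negbTE ne) ltnS /= in fx.
by rewrite leq_subLR addnC -leq_subLR.
Qed.

Local Lemma slide_src x : is_edge x -> x \notin ls -> @src O m' x = src O x.
Proof. by move=> ex xn; rewrite /src; case: O => //=; apply: oppN => //; apply: opp_notin. Qed.

Local Lemma slide_tgt x : is_edge x -> x \notin ls -> @tgt O m' x = tgt O x.
Proof. by move=> ex xn; rewrite /tgt; case: O => //=; apply: oppN => //; apply: opp_notin. Qed.

Local Lemma ls_E' x : x \in ls -> exists2 i, i < k & x = E' i.
Proof.
case/inE_ls=> [[|i] lt ->]; last by exists i; [apply: ltnW | rewrite /E' lt].
by exists k.-1 => //; rewrite /E' k_predK ltnn.
Qed.

Local Lemma E'_in i : E' i \in ls.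
Proof. by rewrite /E'; case: ifP => [/E_in//|_]; apply: mem_head. Qed.

Local Lemma K_edge x : is_edge x -> K (@tgt O m' x) <= (K (@src O m' x)).+1.
Proof.
move=> ex; case: (boolP (x \in ls)) => [/ls_E'[i lt ->]|xn].
  by rewrite -[tgt O _]/(A i.+1) -[src O _]/(Z i) K_A // K_Z.
rewrite slide_src // slide_tgt //; apply: leq_trans (K_src ex xn).
apply: K_leq; case: (OLR) => -> /=; apply: ls_neq => //; exact: opp_notin.
Qed.

Local Lemma K_path u p w : @is_path O m' u p w -> K w <= K u + size p.
Proof.
elim: p u => [|x p IH] u /=; first by move/psi_same; rewrite /K addn0 => ->.
case/and3P; rewrite slide_is_edge => ex /psi_same ux /IH le.
apply: leq_trans le _; rewrite addnS -addSn leq_add2r.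
by rewrite {2}/K ux; apply: K_edge.
Qed.

Local Lemma K_dist u w : @dist O m' u w < #|dart m'| -> K w <= K u + @dist O m' u w.
Proof. by case/dist_path=> p <-; apply: K_path. Qed.

(** * Turning around the vertices of the slid path *)

Let u i j := iter j (turn O) (T i).
Let pos i := findex (turn O) (T i).
Let inside i x := [/\ f x = k - i.+1, x \notin ls & opp x \notin ls].

Local Lemma conTS i : i < k -> fconnect (turn O) (T i) (S i.+1).
Proof. by move=> lt; rewrite fconnect_turn // same_TS. Qed.

Local Lemma pos_u i j : i < k -> j <= pos i (S i.+1) -> pos i (u i j) = j.
Proof.
move=> lt le; apply: findex_iter; apply: leq_ltn_trans le _.
exact/findex_max/conTS.
Qed.

Local Lemma u_pos i : i < k -> u i (pos i (S i.+1)) = S i.+1.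
Proof. by move=> lt; rewrite /u iter_findex // conTS. Qed.

Local Lemma f_u i j : i < k -> f (u i j) = k - i.+1.
Proof. by move=> lt; rewrite -fT //; apply/esym/same_f; apply: iter_turn. Qed.

Local Lemma half_cases x : x \in ls \/ opp x \in ls ->
  exists2 l, l < k & x = S l \/ x = T l.
Proof.
have lsE y : y \in ls -> exists2 l, l < k & y = E l by exact: inE_ls.
case=> /lsE[l lt xE]; exists l => //; rewrite /S /T lt.
  by case: (OLR) => -> /=; [left | right].
have -> : x = opp (E l) by rewrite -xE oppK.
by case: (OLR) => -> /=; [right | left].
Qed.

(** By distances, a half-edge of the path met from [T i] can only be [T i] or [S i.+1], the bounds
    of the light part. At the last vertex, [S k] marks the exit and, unless it is [T k.-1], belongs
    to no edge of the path, so it is allowed. *)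
Local Lemma u_inside i j : i < k -> 0 < j ->
  j < pos i (S i.+1) \/ j = pos i (S i.+1) /\ i.+1 = k -> inside i (u i j).
Proof.
move=> lt j0 jP.
have lejP : j <= pos i (S i.+1) by case: jP => [/ltnW|[->]].
have fu := f_u j lt.
suff off : ~ (u i j \in ls \/ opp (u i j) \in ls).
  by split=> //; apply/negP=> xl; apply: off; [left | right].
case/half_cases=> l ltl [uS|uT].
  have lE : l = i.+1.
    rewrite uS fS 1?ltnW // in fu.
    by rewrite -(subKn (ltnW ltl)) fu subKn.
  case: jP => [|[_ ik]]; last by rewrite lE ik ltnn in ltl.
  by rewrite -{1}(pos_u lt lejP) uS lE ltnn.
have lE : l = i.
  rewrite uT fT // in fu.
  by apply: succn_inj; rewrite -(subKn ltl) fu subKn.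
by move: j0; rewrite -(pos_u lt lejP) uT lE /pos findex0.
Qed.

Local Lemma fe_left : O = LightLeft -> f e = k.
Proof. by move=> OE; have := @fS 0 isT; rewrite /S OE /= subn0. Qed.

Local Lemma e_neq_c_left : O = LightLeft -> e != c.
Proof.
by move=> OE; apply/eqP=> eqec; have := fe_left OE; rewrite eqec fc0 => /eqP.
Qed.

(* Turning from [A i] in the slid map copies turning from [T i] in the initial
   one, until [Z i] is reached. *)
Let w i j : dart m' := if j is 0 then A i else u i j.

Local Lemma turn_left i j : O = LightLeft -> i < k -> (0 < j -> inside i (u i j)) ->
  @turn O m' (w i j) = if turn O (u i j) == c then e else turn O (u i j).
Proof.
move=> OE lt ins.
have ec := e_neq_c_left OE; have fe := fe_left OE.
have turnL x : @turn O m' x = fface (fopp x) by rewrite OE.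
have turnl x : turn O x = face (opp x) by rewrite OE.
have main y : f (face y) = k - i.+1 -> y != e ->
    fface y = if face y == c then e else face y.
  move=> fy ye; rewrite slide_faceE // (negbTE ye); case: eqP => // _.
  case: eqP => // fye; move: fy; rewrite fye fe => /eqP.
  by rewrite eqn_leq leqNgt ltn_subrL.
have fOpp y : f (opp y) = f (face y) by apply/same_f/same_face_opp.
rewrite turnL turnl; case: j ins => [_|j /(_ isT)[fu un oun]]; last first.
  by rewrite [fopp _]oppN // main //; [rewrite -fOpp oppK | apply: ls_neq].
have TE : u i 0 = opp (E i) by rewrite /u /= /T OE.
rewrite TE oppK; case: i lt main TE => [|i] lt main TE; last first.
  have -> : w i.+1 0 = opp (E i) by rewrite -[w _ _]/(A i.+1) AL // ltnW.
  rewrite [fopp _]oppD // main ?E'_neq //.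
  by rewrite -fOpp -fT // /T OE.
(* The half-edge [h0] used to be followed by [e]. As [e] has been cut out, it is now followed by
   [face e], or by [e] inserted before it, just as [T 0] is. *)
rewrite -[w 0 0]/h0 /h0 OE /=; set y := finv face e.
have fy : face y = e by rewrite /y face_finv.
have yn : y \notin ls.
  apply/negP=> /inE_ls[l ltl yE].
  have := fT ltl; rewrite /T OE /= -yE fOpp fy fe => /eqP.
  by rewrite eqn_leq leqNgt ltn_subrL.
have oyn : opp y \notin ls.
  apply/negP=> /fopp_dark[_]; rewrite -dark_face fy.
  by have /andP[/negbTE->] := edge_e.
rewrite [fopp _]oppN ?oppK // slide_faceE // (negbTE (ls_neq yn)) fy eqxx.
by rewrite (negbTE ec).
Qed.

Local Lemma turn_right i j : O = LightRight -> i < k -> (0 < j -> inside i (u i j)) ->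
  @turn O m' (w i j) =
    if u i j == c then opp (E k.-1) else fopp (finv face (u i j)).
Proof.
move=> OE lt ins.
have fE0 : f (face e) = k.
  have := @fS 0 isT; rewrite /S OE /= subn0 => <-.
  by apply/esym/same_f/same_face_opp.
have turnR x y : fface y = x -> @turn O m' x = fopp y.
  move=> <-; rewrite OE /=; congr fopp; exact: (finv_f slide_face_inj).
have nfe y : f y = k - i.+1 -> y != face e.
  move=> fy; apply/eqP=> ye; move: fy; rewrite ye fE0 => /eqP.
  by rewrite eqn_leq leqNgt ltn_subrL.
have main x : f x = k - i.+1 -> x != e ->
    @turn O m' x = if x == c then opp (E k.-1) else fopp (finv face x).
  move=> fx xe; case: eqP => [xc|/eqP xc].
    have ec : e != c by rewrite -xc eq_sym.
    by rewrite (turnR x e) ?[fopp e]oppE0 // slide_faceE // eqxx.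
  apply: turnR; case: (eqVneq e c) => [ec|ec].
    by rewrite /fface /slide_face ec eqxx face_finv.
  rewrite slide_faceE // face_finv // (negbTE xe) (negbTE xc).
  by case: eqP => // ye; case/eqP: (nfe _ fx); rewrite -ye face_finv.
case: j ins => [_|j /(_ isT)[fu un oun]]; last first.
  by apply: main => //; apply: ls_neq.
rewrite -[u i 0]/(T i); case: i lt main nfe => [|i] lt main nfe; last first.
  have -> : w i.+1 0 = T i.+1 by rewrite -[w _ _]/(A i.+1) AR // /E' lt /T OE.
  by apply: main; rewrite ?fT // /T OE E'_neq.
have -> : T 0 = e by rewrite /T OE.
rewrite -[w 0 0]/h0; have -> : h0 = face e by rewrite /h0 OE.
case: eqP => [ec|/eqP ec].
  by rewrite (turnR _ e) ?[fopp e]oppE0 // /fface /slide_face ec eqxx.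
apply: turnR; rewrite slide_faceE // face_finv // eqxx (negbTE ec).
have /negbTE-> : finv face e != e.
  by apply: contra face_e_neq => /eqP{1}<-; rewrite face_finv.
case: eqP => // fec; have := fE0; rewrite fec fc0 => /esym/eqP.
by [].
Qed.

(** Besides placing [A i] and [Z i] at the same vertex w_i, this lists what lies between them, that
    is, what the lightest geodesic for the reverse orientation meets when turning back from
    [Z i]. *)
Local Lemma walk i : i < k ->
  exists2 n, iter n.+1 (@turn O m') (A i) = Z i &
    forall j, j < n -> inside i (iter j.+1 (@turn O m') (A i)).
Proof.
move=> lt.
suff [n wn [wS ins]] : exists2 n, @turn O m' (w i n) = Z i &
    (forall j, j < n -> @turn O m' (w i j) = w i j.+1) /\
    (forall j, j < n -> inside i (u i j.+1)).
  have iterw j : j <= n -> iter j (@turn O m') (A i) = w i j.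
    by elim: j => // j IH ltj; rewrite iterS IH 1?ltnW // wS.
  by exists n => [|j ltj]; [rewrite iterS iterw | rewrite iterw //; apply: ins].
have posS := u_pos lt; set P := pos i (S i.+1) in posS.
have uS j : turn O (u i j) = u i j.+1 by [].
case: (OLR) => OE.
  case: (ltnP i.+1 k) => [lt'|ge].
    have SE : S i.+1 = E i.+1 by rewrite /S lt' OE.
    have ST := STneq lt (fun _ => face_E_neq_c OE lt').
    have P0 : 0 < P.
      by rewrite lt0n; apply: contra ST => /eqP P0; rewrite -posS P0.
    have uc j : (u i j == c) = false.
      apply/eqP=> uc; have := f_u j lt; rewrite uc fc0 => /esym/eqP.
      by rewrite subn_eq0 leqNgt lt'.
    have ins j : 0 < j -> j < P -> inside i (u i j).
      by move=> j0 jP; apply: u_inside => //; left.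
    exists P.-1.
      rewrite turn_left // => [|j0]; last by apply: ins; rewrite // prednK.
      by rewrite uS prednK // uc posS ZL // /E' lt'.
    split=> j jP; have jP' : j.+1 < P by rewrite -(prednK P0) ltnS.
      by rewrite turn_left // ?uS ?uc // => j0; apply: ins => //; apply: ltnW.
    exact: ins.
  have ik : i.+1 = k by apply/eqP; rewrite eqn_leq lt ge.
  have ins j : 0 < j -> j <= P -> inside i (u i j).
    move=> j0; rewrite leq_eqVlt => jP; apply: u_inside => //.
    by case/orP: jP => [/eqP|]; [right | left].
  have tS : turn O (S k) = c by rewrite OE [turn _ _]node_Sk.
  (* At the last vertex for light-left, [S k] is passed before [e] is met, [e] being now in front of
     [c]: hence one step more than in the other cases. *)
  exists P.
    rewrite turn_left // => [|j0]; last exact: ins.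
    by rewrite posS ik tS eqxx ZL // /E' ik ltnn.
  split=> j jP; last exact: ins.
  rewrite turn_left // => [|j0]; last by apply: ins => //; apply: ltnW.
  case: eqP => // ujc; have : u i j = S k.
    by apply: (@turn_inj _ face_inj oppK O); rewrite ujc tS.
  rewrite -ik -posS => /(congr1 (pos i)); rewrite !pos_u ?leqnn // 1?ltnW // => jE.
  by rewrite jE ltnn in jP.
have ST : S i.+1 != T i by apply: STneq => //; rewrite OE.
have P0 : 0 < P.
  by rewrite lt0n; apply: contra ST => /eqP P0; rewrite -posS P0.
have ins j : 0 < j -> j < P -> inside i (u i j).
  by move=> j0 jP; apply: u_inside => //; left.
have tE x : turn O x = opp (finv face x) by rewrite OE.
have Zi : Z i = opp (E i) by apply: ZR.
exists P.-1.
  rewrite turn_right // => [|j0]; last by apply: ins; rewrite // prednK.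
  have : turn O (u i P.-1) = S i.+1 by rewrite uS prednK.
  rewrite /S; case: ltnP => [lt'|ge].
    rewrite tE OE /= => /(opp_inj oppK) ->; rewrite [fopp _]oppES // Zi.
    case: eqP => // uc; have := f_u P.-1 lt; rewrite uc fc0 => /esym/eqP.
    by rewrite subn_eq0 leqNgt lt'.
  have ik : i.+1 = k by apply/eqP; rewrite eqn_leq lt ge.
  rewrite tE => /(opp_inj oppK)/(congr1 face); rewrite !face_finv // => ->.
  by rewrite eqxx Zi -ik.
split=> j jP; have jP' : j.+1 < P by rewrite -(prednK P0) ltnS.
  rewrite turn_right // => [|j0]; last by apply: ins => //; apply: ltnW.
  have [_ un oun] := ins j.+1 isT jP'.
  have oE : opp (finv face (u i j)) = u i j.+1 by rewrite -tE.
  case: eqP => [uc|_].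
    have ik : i.+1 = k.
      apply/eqP; rewrite eqn_leq lt -subn_eq0.
      by have := f_u j lt; rewrite uc fc0 => <-.
    have : u i j.+1 = S i.+1 by rewrite -oE uc ik Sk.
    rewrite -posS => /(congr1 (pos i)); rewrite !pos_u ?leqnn // 1?ltnW // => jE.
    by rewrite jE ltnn in jP'.
  by rewrite [fopp _]oppN ?oE // -(oppK (finv _ _)) oE.
exact: ins.
Qed.

(** * The slid path is a geodesic, lightest when read backwards *)

Let cc := slide_corner e c O.

Local Lemma same_AZ i : i < k -> @same_vertex m' (A i) (Z i).
Proof.
by case/walk=> n <- _; apply: iter_turn; [apply: slide_face_inj | apply: slide_oppK].
Qed.

Local Lemma same_corner : @same_vertex m' cc (A 0).
Proof.
case: (OLR) => OE; last by rewrite /cc /slide_corner OE /A /h0 OE same_vertex_refl.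
have <- : @turn O m' (A 0) = cc.
  rewrite (@turn_left 0 0) // /u /= /T /cc /slide_corner OE /=.
  by rewrite /node oppK.
rewrite same_vertex_sym; [|exact: slide_face_inj|exact: slide_oppK].
by apply: same_turn; [apply: slide_face_inj | apply: slide_oppK].
Qed.

Local Lemma K_corner : K cc = 0.
Proof.
rewrite -(@K_Z 0) // /K (psi_same same_corner) (psi_same (same_AZ _)) //.
Qed.

Local Lemma slide_path j : j <= k -> @is_path O m' cc (mkseq E' j) (A j).
Proof.
elim: j => [|j IH] lt; first exact: same_corner.
rewrite mkseqS -cats1; apply: (is_path_cat slide_face_inj slide_oppK (IH (ltnW lt))).
rewrite /= slide_is_edge same_vertex_refl andbT.
rewrite -[src _ _]/(Z j) same_AZ // andbT.
by have [i lti ->] := inE_ls (E'_in j); apply: edgeE.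
Qed.

(** The slid path gives the upper bound; the lower one comes from the potential, which is 0 at [cc]
    and [j] at [A j]. *)
Local Lemma dist_A j : j <= k -> @dist O m' cc (A j) = j.
Proof.
move=> le; have p := slide_path le.
have := dist_leq p; rewrite size_mkseq => le'.
apply/eqP; rewrite eqn_leq le' /=.
have := K_dist (dist_lt_card p); rewrite K_corner add0n; apply: leq_trans.
by case: j le {p le'} => // j lt; rewrite K_A.
Qed.

Local Lemma dist_Z j : j < k -> @dist O m' cc (Z j) = j.
Proof.
move=> lt; rewrite -{2}(dist_A (ltnW lt)); apply: distr.
- exact: slide_face_inj.
- exact: slide_oppK.
rewrite same_vertex_sym ?same_AZ //; [exact: slide_face_inj | exact: slide_oppK].
Qed.

Lemma slide_leaving : @leaving O m' cc e.
Proof.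
have eE : e = E' k.-1 by rewrite /E' k_predK ltnn.
rewrite /leaving eE -[tgt O _]/(A k.-1.+1) -[src O _]/(Z k.-1).
by rewrite dist_A // dist_Z.
Qed.

(** The end of the edge being at distance [k - i.+1] from [c], [K_src] bounds the potential of its
    origin from below. Such an edge thus cannot start a step closer to [cc] when read backwards. *)
Local Lemma inside_candidate i x :
    i < k -> is_edge x -> inside i (@tgt O m' x) -> i <= K (@src O m' x).
Proof.
move=> lt ex [ft tn otn].
have xn : x \notin ls.
  apply/negP=> xl; case: (OLR) => OE.
    move: otn; rewrite OE /= -[slide_opp ls]/fopp.
    by have [l ltl ->] := ls_E' xl; rewrite fopp_E' // oppK E_in.
  by move: tn; rewrite OE /= xl.
rewrite slide_tgt // in ft; rewrite slide_src //.
by have := K_src ex xn; rewrite ft subKn.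
Qed.

Local Lemma slide_lightest_rec j : j < k ->
  @is_lightest m' (reverse O) (Z j) cc (rev (mkseq E' j)).
Proof.
have sfi := slide_face_inj; have sok := slide_oppK.
have nsame x : 0 < K x -> ~~ @same_vertex m' x cc.
  by move=> Kx; apply/negP=> /psi_same sx; move: Kx; rewrite /K sx -/(K cc) K_corner.
elim: j => [|j IH] lt.
  change (is_true (@same_vertex m' (Z 0) cc)).
  by apply: (@same_vertex_trans m' (A 0)); rewrite same_vertex_sym ?same_AZ ?same_corner.
have lt' := ltnW lt.
rewrite mkseqS rev_rcons; split.
- by apply: nsame; rewrite K_Z.
- rewrite /candidate slide_is_edge !dist_reverse //.
  rewrite tgt_reverse -[src O _]/(Z j) !dist_Z // ?eqxx ?andbT.
  by have [i lti ->] := inE_ls (E'_in j); apply: edgeE.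
- have [n wn ins] := walk lt; exists n.
    by rewrite src_reverse -wn iter_turnK.
  (* Turning back from [Z j.+1] meets the half-edges of [walk] in reverse order. A candidate [x]
     found among them would start at distance [j] from [cc], hence at potential at most [j], against
     [inside_candidate]. *)
  move=> l ltl; set x := edge_from _ _.
  have srcx : @src (reverse O) m' x = iter (n - l) (@turn O m') (A j.+1).
    rewrite edge_fromK // -wn.
    rewrite -{1}(subnKC (leqW ltl)) [l.+1 + _]addnC addnC iterD.
    by rewrite iter_turnK // subSS.
  rewrite src_reverse in srcx.
  apply/negP; rewrite /candidate slide_is_edge => /andP[ex].
  rewrite !dist_reverse //.
  rewrite dist_Z // tgt_reverse eqSS => /eqP dj.
  have ltj : j < #|dart m'| by have := @dist_leq_card m' O cc (Z j.+1); rewrite dist_Z.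
  have Kle := @K_dist cc (@src O m' x); rewrite K_corner add0n dj in Kle.
  have : j.+1 <= K (@src O m' x).
    apply: inside_candidate => //; rewrite srcx -(prednK (_ : 0 < n - l)) ?subn_gt0 //.
    by apply: ins; rewrite -subn1 -subnDA addn1 ltn_subrL /= (leq_ltn_trans _ ltl).
  by rewrite ltnNge Kle.
by rewrite tgt_reverse; apply: IH.
Qed.

Lemma slide_lightest :
  is_lightest (reverse O)
    (@corner_start (reverse O) m' (@corner_preceding (reverse O) m' e)) cc
    (e :: rev s).
Proof.
have sfi := slide_face_inj; have sok := slide_oppK.
have tc := turn_corner_start sfi sok (reverse O) e.
set h := corner_start _ _ in tc *.
have eE : e = E' k.-1 by rewrite /E' k_predK ltnn.
have sk : @same_vertex m' h (A k).
  have := same_turn sfi sok (reverse O) h; rewrite tc src_reverse.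
  by rewrite [X in tgt O X]eE.
have sE : s = mkseq E' k.-1.
  apply: (@eq_from_nth _ e) => [|i lti]; first by rewrite size_mkseq.
  by rewrite nth_mkseq // /E' ltnS lti.
have edge_e' : @is_edge m' e by rewrite slide_is_edge edge_e.
split.
- apply/negP=> hc.
  have := K_A k_pred; rewrite k_predK.
  by rewrite /K -(psi_same sk) (psi_same hc) -/(K cc) K_corner.
- rewrite /candidate edge_e' !dist_reverse // (distr sfi sok _ _ sk) dist_A //.
  by rewrite tgt_reverse [X in src O X]eE -[src O _]/(Z k.-1) dist_Z // eqxx.
- by exists 0.
by rewrite tgt_reverse [X in src O X]eE sE; apply: slide_lightest_rec.
Qed.

(** * Faces of the slid map *)

Let unslide (x : dart m) := if x == e then c else x.

Local Lemma fconnect_unslide x : fconnect face (unslide x) (unslide (fface x)).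
Proof.
rewrite /unslide; case: (eqVneq e c) => [ec|ec].
  have unE y : (if y == e then c else y) = y by case: eqP => // ->; rewrite ec.
  by rewrite !unE /fface /slide_face ec eqxx fconnect1.
rewrite slide_faceE //; case: (eqVneq x e) => [_|xe].
  by rewrite eq_sym (negbTE ec) connect0.
case: (eqVneq (face x) c) => [<-|fxc]; first by rewrite eqxx fconnect1.
case: (eqVneq (face x) e) => [fxe|nfxe]; last by rewrite (negbTE nfxe) fconnect1.
have cx : fconnect face x (face e) by rewrite -fxe (fconnect_iter face 2 x).
case: (eqVneq (face e) c) => [fec|_]; first by rewrite eqxx -fec.
by rewrite (negbTE face_e_neq).
Qed.

(** Contours are sent to contours in both directions by maps that fix all darts but [e]: [unslide]
    sends [e] to [c], its new face, and [skip] sends it to [face e], in its old face. *)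
Local Lemma fconnect_slide x y :
  x != e -> y != e -> fconnect (@face m') x y = fconnect face x y.
Proof.
move=> xe ye; apply/idP/idP => [/(fconnect_homo fconnect_unslide)|].
  by rewrite /unslide (negbTE xe) (negbTE ye).
pose skip z := if z == e then face e else z.
have skipE z : z != e -> skip z = z by rewrite /skip => /negbTE->.
rewrite -{2}(skipE x) // -{2}(skipE y) //; apply: fconnect_homo; clear x y xe ye => x.
case: (eqVneq e c) => [ec|ec].
  have fE : @face m' =1 @face m by move=> z; rewrite /= /slide_face ec eqxx.
  have conE z t : fconnect (@face m') z t = fconnect (@face m) z t.
    exact: (@eq_fconnect (dart m) (@face m') (@face m) fE).
  rewrite conE /skip; case: (eqVneq x e) => [->|xe].
    by rewrite (negbTE face_e_neq) connect0.
  case: eqP => [fxe|_]; last exact: fconnect1.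
  by rewrite -fxe (fconnect_iter face 2 x).
have face'E z : @face m' z = fface z by [].
have con1 z : fconnect (@face m') z (fface z) by apply: fconnect1.
have con2 z : fconnect (@face m') z (fface (fface z)) by apply: (fconnect_iter _ 2).
have fe : fface e = c by rewrite slide_faceE // eqxx.
rewrite /skip; case: (eqVneq x e) => [->|xe].
  by rewrite (negbTE face_e_neq) connect0.
have fx := slide_faceE x ec; rewrite (negbTE xe) in fx.
case: (eqVneq (face x) c) fx => [fxc|fxc] fx.
  by rewrite eq_sym fxc (negbTE ec) -fe -fx con2.
case: (eqVneq (face x) e) fx => [fxe|nfxe] fx; last by rewrite -fx con1.
case: eqP fx => [fec|_] fx; last by rewrite -fx con1.
by rewrite fec -fe -fx con2.
Qed.

Local Lemma dark_orbit x y : fconnect face x y -> dark y = dark x.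
Proof.
by move/iter_findex <-; elim: (findex _ _ _) => //= n <-; rewrite dark_face.
Qed.

Local Lemma slide_dark_orbit x y : fconnect (@face m') x y -> dark y = dark x.
Proof.
move/iter_findex <-; elim: (findex _ _ _) => //= n <-.
exact: slide_dark_face.
Qed.

Lemma slide_order_dark x : dark x -> order (@face m') x = order face x.
Proof.
move=> dx; apply: eq_card => y; rewrite !inE.
case: (eqVneq y e) => [->|ye]; last exact: fconnect_slide (dark_neq dx) ye.
have /andP[/negbTE le _] := edge_e.
by apply/idP/idP => [/slide_dark_orbit|/dark_orbit]; rewrite dx le.
Qed.

Local Lemma slide_dangling_face x : x != e ->
  [pred y | fconnect (@face m') x y & @dangling m' y]
    =i [pred y | fconnect face x y & dangling y].
Proof.
move=> xe y; rewrite !inE slide_dangling; case: (eqVneq y e) => [->|ye].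
  by have /andP[_ /negbTE->] := edge_e; rewrite !andbF.
by rewrite fconnect_slide.
Qed.

Lemma slide_dangling_card x :
    (forall x, ~~ dark x -> #|[pred y | fconnect face x y & dangling y]| = 1) ->
    ~~ dark x ->
  #|[pred y | fconnect (@face m') x y & @dangling m' y]| = 1.
Proof.
move=> card1 lx; case: (eqVneq x e) => [->|xe].
  case: (eqVneq e c) => [ec|ec].
    have fE : @face m' =1 @face m by move=> z; rewrite /= /slide_face ec eqxx.
    have /andP[le _] := edge_e; rewrite -(card1 _ le); apply: eq_card => y.
    by rewrite !inE slide_dangling (eq_fconnect fE).
  have ec' : c != e by rewrite eq_sym.
  rewrite -(card1 _ c_light) -(eq_card (slide_dangling_face ec')).
  apply: eq_card => y; rewrite !inE; congr (_ && _).
  have -> : c = @face m' e by rewrite [RHS]slide_faceE // eqxx.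
  by rewrite -(same_fconnect1 slide_face_inj).
by rewrite (eq_card (slide_dangling_face xe)) card1.
Qed.

(** * Connectedness of the slid map *)

Let glob := connect [rel a b : dart m' | (b == face a) || (b == opp a)].

Local Lemma glob_face x : glob x (fface x).
Proof. by apply: connect1; rewrite /= eqxx. Qed.

Local Lemma glob_opp x : glob x (fopp x).
Proof. by apply: connect1; rewrite /= eqxx orbT. Qed.

Local Lemma glob_trans y x z : glob x y -> glob y z -> glob x z.
Proof. exact: connect_trans. Qed.

Local Lemma glob_iter n x : glob x (iter n fface x).
Proof.
elim: n => [|n IH]; first exact: connect0.
by apply: glob_trans IH _; rewrite iterS glob_face.
Qed.

Local Lemma glob_sym x y : glob x y -> glob y x.
Proof.
case/connectP=> p; elim: p x => [|z p IH] x /=; first by move=> _ ->; apply: connect0.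
case/andP=> xz /IH{}IH /IH yz; apply: glob_trans yz _.
case/orP: xz => /eqP->; last by rewrite -{2}(slide_oppK x) glob_opp.
have cx : fconnect (@face m') (@face m' x) x.
  by rewrite (fconnect_sym slide_face_inj) fconnect1.
have := glob_iter (findex (@face m') (@face m' x) x) (@face m' x).
by rewrite [X in glob _ X](iter_findex cx).
Qed.

Local Lemma glob_same x y : @same_vertex m' x y -> glob x y.
Proof.
move/iter_findex <-; elim: (findex _ _ _) => [|n IH]; first exact: connect0.
apply: glob_trans IH _; rewrite iterS.
exact: glob_trans (glob_opp _) (glob_face _).
Qed.

Local Lemma glob_ZA i : i < k -> glob (Z i) (A i.+1).
Proof.
move=> lt; rewrite /Z /A; case: (O) => /=; first exact: glob_opp.
by rewrite -[X in glob _ X]slide_oppK; apply: glob_opp.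
Qed.

Local Lemma glob_corner j : j <= k -> glob cc (A j).
Proof.
elim: j => [|j IH] lt; first by apply: glob_same; apply: same_corner.
apply: glob_trans (IH (ltnW lt)) _; apply: glob_trans (glob_ZA lt).
by apply: glob_same; apply: same_AZ.
Qed.

Local Lemma glob_corner_Z j : j < k -> glob cc (Z j).
Proof.
move=> lt; apply: glob_trans (glob_corner (ltnW lt)) _.
by apply: glob_same; apply: same_AZ.
Qed.

Local Lemma glob_ls i : i < k -> glob cc (E' i) /\ glob cc (opp (E i)).
Proof.
move=> lt; have gZ := glob_corner_Z lt; have gA := glob_corner lt.
case: (OLR) => OE; first by rewrite ZL // in gZ; rewrite AL // in gA.
by rewrite ZR // in gZ; rewrite AR // in gA.
Qed.

(** Each adjacency destroyed by sliding is replaced by a chain through the slid path, all of whose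
    darts are linked to [cc]. *)
Lemma slide_connected : connected_map m -> connected_map m'.
Proof.
move=> con x y.
have ge : glob cc e.
  by have [] := glob_ls k_pred; rewrite /E' k_predK ltnn.
have gls (z : dart m) : z \in ls -> glob cc z by case/ls_E'=> i lt ->; case: (glob_ls lt).
have gopp (z : dart m) : glob z (@opp m z).
  case: (boolP (z \in ls)) => [zls|zn].
    have := glob_trans (glob_sym (gls _ zls)).
    by have [i lt ->] := inE_ls zls; apply; case: (glob_ls lt).
  case: (boolP (opp z \in ls)) => [ozl|ozn]; last by rewrite -oppN ?glob_opp.
  apply: glob_trans (gls _ ozl); apply: glob_sym.
  have [i lt ozE] := inE_ls ozl; have -> : z = opp (E i) by rewrite -ozE oppK.
  by case: (glob_ls lt).
have gfe : glob e (@face m e).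
  case: (eqVneq e c) => [ec|ec].
    by have := glob_face e; rewrite /fface /slide_face ec eqxx.
  have ccE : cc = (if O is LightLeft then if face e == c then e else face e else face e) by [].
  case: (eqVneq (face e) c) => [->|nfe].
    by have := glob_face e; rewrite slide_faceE // eqxx.
  have <- : cc = face e by rewrite ccE (negbTE nfe); case: (O).
  exact: glob_sym.
have gface (z : dart m) : glob z (@face m z).
  case: (eqVneq e c) => [ec|ec].
    by have := glob_face z; rewrite /fface /slide_face ec eqxx.
  have := glob_face z; rewrite slide_faceE //.
  case: (eqVneq z e) => [->//|ze].
  case: (eqVneq (face z) c) => [-> gze|_].
    by apply: glob_trans gze _; have := glob_face e; rewrite slide_faceE // eqxx.
  case: (eqVneq (face z) e) => [->|//]; case: eqP => // _ gz.
  by apply: glob_trans gz _; apply: glob_sym.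
have := con x y; apply: (@connect_sub (dart m)) => a b /orP[]/eqP->.
  exact: gface.
exact: gopp.
Qed.

Lemma slide_hyper : hyper m'.
Proof.
split.
- exact: slide_face_inj.
- exact: slide_oppK.
- exact: slide_dark_face.
- exact: slide_dark_opp.
- by move=> x dx; rewrite slide_dangling; apply: (hyper_dark m_hyper dx).
move=> x lx.
have light1 z : z != e -> ~~ dark z -> exists2 y, fconnect (@face m') z y & @dangling m' y.
  move=> ze lz; have [y zy dy] := hyper_light m_hyper lz.
  exists y; last by rewrite slide_dangling.
  rewrite fconnect_slide //; apply: contraTneq dy => ->.
  by have /andP[] := edge_e.
case: (eqVneq x e) => [->|xe]; last exact: light1.
case: (eqVneq e c) => [ec|ec].
  have fE : @face m' =1 @face m by move=> z; rewrite /= /slide_face ec eqxx.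
  have /andP[le _] := edge_e; have [y zy dy] := hyper_light m_hyper le.
  by exists y; rewrite ?slide_dangling // (eq_fconnect fE).
have [|y cy dy] := @light1 c _ c_light; first by rewrite eq_sym.
exists y => //; apply: connect_trans cy.
have -> : c = @face m' e by rewrite [RHS]slide_faceE // eqxx.
exact: fconnect1.
Qed.

Lemma slide_fcard_node : fcard (@node m) (dart m) <= fcard (@node m') (dart m').
Proof.
apply: (fcard_leq (h := psi)).
- exact: node_inj slide_face_inj slide_oppK.
- exact: psi_node.
(* The vertex v_j is the image of w_j, taken at [Z j] or, for [j = k], at [A k]. Any other vertex is
   intact, so that [x] is its own witness; it differs from [e], which lies on the path. *)
move=> x; case: (boolP [exists j : 'I_k.+1, same_vertex x (S j)]) => [/existsP[j]|no].
  move/froot_same->; case: j => [j ltj] /=; rewrite ltnS leq_eqVlt in ltj.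
  case/orP: ltj => [/eqP->|ltj]; last by exists (Z j); apply: psi_Z.
  by exists (A k.-1.+1); rewrite psi_A.
have noS j : j <= k -> ~~ same_vertex x (S j).
  by move=> le; move: no; rewrite negb_exists => /forallP/(_ (Ordinal (le : j < k.+1))).
have noT i : i < k -> ~~ same_vertex (T i) x.
  move=> lt; apply: contra (noS _ lt) => Tx.
  rewrite same_vertex_sym //; apply: same_vertex_trans Tx.
  by rewrite same_vertex_sym // same_TS.
exists x; rewrite /psi ifN.
  by case: pickP => // i /lam_same; rewrite (negbTE (noT i (ltn_ord i))).
apply/eqP=> xe; case: (OLR) => OE.
  by have := noS 0 isT; rewrite /S OE xe /= same_vertex_refl.
by have := noT 0 isT; rewrite /T OE xe /= same_vertex_refl.
Qed.

Lemma slide_fcard_face : fcard (@face m) (dart m) <= fcard (@face m') (dart m').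
Proof.
have fsym := fconnect_sym face_inj.
apply: (fcard_leq (h := fun x => froot face (unslide x))).
- exact: slide_face_inj.
- by move=> x; apply/esym/(rootP fsym); apply: fconnect_unslide.
move=> x; case: (eqVneq x e) => [->|xe]; last by exists x; rewrite /unslide (negbTE xe).
(* The dart [e] has changed faces, but [face e] still represents the old one. *)
exists (face e); rewrite /unslide (negbTE face_e_neq); apply/(rootP fsym).
by rewrite fsym fconnect1.
Qed.

Lemma slide_fcard_opp :
  fcard (@opp m') [predC @dangling m'] = fcard (@opp m) [predC @dangling m].
Proof.
apply/eqP; rewrite -(@eqn_pmul2r 2) //; apply/eqP.
rewrite !fcard_opp //; last exact: slide_oppK.
by apply: eq_card => x; rewrite !inE -!topredE /= slide_dangling.
Qed.

(** * Sliding twice *)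

Local Lemma face_e_neq_c : O = LightRight -> face e != c.
Proof.
move=> OE; apply/eqP=> fec; have := @fS 0 isT; rewrite /S OE /= subn0.
by rewrite (same_f (same_face_opp oppK e)) fec fc0.
Qed.

Lemma slide_light_corner : ~~ dark cc.
Proof.
have /andP[le _] := edge_e; rewrite /cc /slide_corner.
by case: (O); first case: ifP => _; rewrite ?dark_face.
Qed.

Lemma slide_edge : @is_edge m' e.
Proof. by rewrite slide_is_edge edge_e. Qed.

(** Reversing the orientation exchanges the degenerate cases: [e = c], for light-right, gives
    [face e = cc], and [face e = c], for light-left, gives [e = cc]. In both, neither slide changes
    the contours. *)
Lemma slide_slide_face x : @slide_face m' e cc x = face x.
Proof.
rewrite /slide_face /= /slide_face; case: (eqVneq e c) => [ec|ec].
  have OE : O = LightRight.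
    by case: (OLR) => // OE; case/eqP: (e_neq_c_left OE).
  rewrite /cc /slide_corner OE eq_sym (negbTE face_e_neq).
  exact: tpermK.
rewrite tpermR tpermL /cc /slide_corner.
case: (eqVneq (face e) c) => [fec|nfec].
  case: (OLR) => OE; last by case/eqP: (face_e_neq_c OE).
  by rewrite OE eqxx fec tpermK.
have -> : (if O is LightLeft then face e else face e) = face e by case: (O).
by rewrite [e == _]eq_sym (negbTE face_e_neq) !tpermK.
Qed.

Lemma slide_slide_corner : @slide_corner m' e cc (reverse O) = c.
Proof.
rewrite /slide_corner /= /slide_face; case: (eqVneq e c) => [ec|ec].
  have OE : O = LightRight.
    by case: (OLR) => // OE; case/eqP: (e_neq_c_left OE).
  by rewrite /cc /slide_corner OE /= eqxx.
rewrite tpermR tpermL; case: (OLR) => OE; rewrite OE //=.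
by rewrite ifN // eq_sym /cc /slide_corner OE face_e_neq_c.
Qed.

(** The sequence [e :: rev s] is a rotation of [rev ls], which exchanges [next] and [prev]: the
    second cyclic shift undoes the first. *)
Lemma slide_slide_opp x : @slide_opp m' (e :: rev s) x = opp x.
Proof.
have lsE : e :: rev s = rotr 1 (rev ls) by rewrite rev_cons rotr1_rcons.
have ur : uniq (rev ls) by rewrite rev_uniq uniq_ls.
have nE y : next (e :: rev s) y = prev ls y by rewrite lsE next_rotr // next_rev // uniq_ls.
have pE y : prev (e :: rev s) y = next ls y by rewrite lsE prev_rotr // prev_rev // uniq_ls.
have mE y : (y \in e :: rev s) = (y \in ls) by rewrite !inE mem_rev.
rewrite /slide_opp nE pE !mE -/fopp -[opp x in RHS]/(@opp m x).
have oE y : @opp m' y = fopp y by [].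
rewrite !oE; case: (boolP (x \in ls)) => [xls|xn].
  by rewrite /fopp /slide_opp mem_next xls prev_next // uniq_ls.
case: (boolP (opp x \in ls)) => [oxl|oxn].
  have [-> _] := fopp_dark oxl.
  by rewrite /fopp /slide_opp (negbTE xn) oxl prev_next // uniq_ls.
by rewrite oppN // (negbTE oxn).
Qed.

(** * Comparison with slit-slide-sew *)

Let ce := corner_preceding O e.
Let m1 := slit_slide_sew ce c e s.
Let z0 : {z : dart m1 | kept e z} := exist _ (inr false) (kept_new e).

Local Lemma same_ce : same_vertex ce (S 0).
Proof. by rewrite /S /=; apply: same_corner_preceding. Qed.

Local Lemma ce_neq_c : ce != c.
Proof.
apply/eqP=> eqc; have := @fS 0 isT.
by rewrite -(same_f same_ce) eqc fc0 subn0.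
Qed.

Local Lemma sss_face_inj : injective (@face m1).
Proof.
have cec := negbTE ce_neq_c.
have cce : (c == ce) = false by rewrite eq_sym.
move=> [x|[]] [y|[]] //=.
- case: (eqVneq (face x) ce) => [xe|xe]; case: (eqVneq (face y) ce) => [ye|ye].
  + by move=> _; congr inl; apply: face_inj; rewrite xe ye.
  + by case: ifP.
  + by case: ifP.
  case: (eqVneq (face x) c) => [xc|xc]; case: (eqVneq (face y) c) => [yc|yc] //.
    by move=> _; congr inl; apply: face_inj; rewrite xc yc.
  by case=> /face_inj->.
- case: (eqVneq (face x) ce) => // xe; case: (eqVneq (face x) c) => // xc.
  by case=> xe'; rewrite xe' eqxx in xe.
- case: (eqVneq (face x) ce) => // xe; case: (eqVneq (face x) c) => // xc.
  by case=> xe'; rewrite xe' eqxx in xc.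
- case: (eqVneq (face y) ce) => // ye; case: (eqVneq (face y) c) => // yc.
  by case=> ye'; rewrite -ye' eqxx in ye.
- by case=> /eqP; rewrite cec.
- case: (eqVneq (face y) ce) => // ye; case: (eqVneq (face y) c) => // yc.
  by case=> ye'; rewrite -ye' eqxx in yc.
by case=> /eqP; rewrite cce.
Qed.

Local Lemma next_keptE n (x : dart m1) :
    kept e (iter n face (face x)) ->
    (forall j, j < n -> ~~ kept e (iter j face (face x))) ->
  val (@next_kept m1 (kept e) z0 x) = iter n face (face x).
Proof.
move=> kn kj; rewrite /next_kept.
have [r ->] := filter_orbit sss_face_inj kn kj.
by rewrite val_insubd kn.
Qed.

Let ret (z : {z : dart m1 | kept e z}) : dart m := if val z is inl x then x else e.

Local Lemma keptE x : kept e (inl x : dart m1) = (x != e).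
Proof. by rewrite /kept !inE orbF. Qed.

Local Lemma ret_eq z (t : dart m1) : val z = t ->
  ret z = if t is inl x then x else e.
Proof. by rewrite /ret => ->. Qed.

Local Lemma sss_faceE x : @face m1 (inl x) =
  if face x == ce then inr true else if face x == c then inr false else inl (face x).
Proof. by []. Qed.

(** The skipped darts [inl e] and [inr true] are consecutive in a contour, [inr true] coming first
    for light-left and second for light-right; hence the numbers of skipped darts, 0 or 2. *)
Local Lemma ret_next (z : dart m1) : kept e z ->
  ret (@next_kept m1 (kept e) z0 z) = fface (if z is inl x then x else e).
Proof.
move=> kz; case: (OLR) => OE.
  have ceE : ce = e by rewrite /ce OE.
  have ec := e_neq_c_left OE.
  have ec' : c != e by rewrite eq_sym.
  case: z kz => [x|[]] kz //; last first.
    by rewrite (ret_eq (@next_keptE 0 _ _ _)) //= ?keptE // slide_faceE // eqxx.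
  rewrite keptE in kz; rewrite slide_faceE // (negbTE kz).
  case: (eqVneq (face x) c) => [fxc|fxc].
    have fx : @face m1 (inl x) = inr false.
      by rewrite sss_faceE fxc ceE eq_sym (negbTE ec) eqxx.
    by rewrite (ret_eq (@next_keptE 0 _ _ _)) // ?[iter _ _ _]fx.
  case: (eqVneq (face x) e) => [fxe|nfxe].
    have fx : @face m1 (inl x) = inr true by rewrite sss_faceE fxe ceE eqxx.
    have ffx : iter 2 (@face m1) (@face m1 (inl x)) =
        if face e == c then inr false else inl (face e).
      by rewrite fx /= ceE (negbTE face_e_neq).
    rewrite (ret_eq (@next_keptE 2 _ _ _)) ?ffx.
    - by case: eqP.
    - by case: eqP; rewrite // keptE face_e_neq.
    by case=> [|[|//]] _; rewrite fx //= ceE keptE eqxx.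
  have fx : @face m1 (inl x) = inl (face x).
    by rewrite sss_faceE ceE (negbTE nfxe) (negbTE fxc).
  by rewrite (ret_eq (@next_keptE 0 _ _ _)) // ?[iter _ _ _]fx ?keptE.
have ceE : ce = face e by rewrite /ce OE.
have fec := face_e_neq_c OE.
have jump (t : dart m1) : @face m1 t = inl e -> ret (@next_kept m1 (kept e) z0 t) = face e.
  move=> ft.
  have ffx : iter 2 (@face m1) (@face m1 t) = inl (face e).
    by rewrite ft /= ceE eqxx.
  rewrite (ret_eq (@next_keptE 2 _ _ _)) ?ffx //; first by rewrite keptE face_e_neq.
  by case=> [|[|//]] _; rewrite ft ?keptE ?eqxx //= ceE eqxx.
case: z kz => [x|[]] kz //; last first.
  case: (eqVneq e c) => [ec|ec].
    by rewrite jump; rewrite /fface /slide_face ec /= ?eqxx.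
  rewrite slide_faceE // eqxx.
  by rewrite (ret_eq (@next_keptE 0 _ _ _)) //= ?keptE // eq_sym.
rewrite keptE in kz.
have fxe : face x != face e by apply: contra kz => /eqP/face_inj->.
have fx : @face m1 (inl x) = if face x == c then inr false else inl (face x).
  by rewrite sss_faceE ceE (negbTE fxe).
case: (eqVneq (face x) c) fx => [fxc|fxc] fx.
  rewrite (ret_eq (@next_keptE 0 _ _ _)) // ?[iter _ _ _]fx //.
  case: (eqVneq e c) => [ec|ec]; first by rewrite /fface /slide_face ec eqxx fxc.
  by rewrite slide_faceE // (negbTE kz) fxc eqxx.
case: (eqVneq (face x) e) => [fxe'|nfxe].
  have ec : e != c by rewrite -fxe'.
  rewrite jump; last by rewrite fx fxe'.
  by rewrite slide_faceE // (negbTE kz) (negbTE fxc) fxe' eqxx (negbTE fec).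
rewrite (ret_eq (@next_keptE 0 _ _ _)) // ?[iter _ _ _]fx ?keptE //.
case: (eqVneq e c) => [ec|ec]; first by rewrite /fface /slide_face ec eqxx.
by rewrite slide_faceE // (negbTE kz) (negbTE fxc) (negbTE nfxe).
Qed.

Local Lemma ret_corner : ret (@next_kept m1 (kept e) z0 (inr true)) = cc.
Proof.
case: (OLR) => OE.
  have ceE : ce = e by rewrite /ce OE.
  have ffx : iter 1 (@face m1) (@face m1 (inr true)) =
      if face e == c then inr false else inl (face e).
    by rewrite /= ceE (negbTE face_e_neq).
  rewrite (ret_eq (@next_keptE 1 _ _ _)) ?ffx.
  - by rewrite /cc /slide_corner OE; case: eqP.
  - by case: eqP; rewrite // keptE face_e_neq.
  by case=> // _; rewrite /= ceE keptE eqxx.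
have ceE : ce = face e by rewrite /ce OE.
rewrite (ret_eq (@next_keptE 0 _ _ _)) //=; last by rewrite ceE keptE face_e_neq.
by rewrite /cc /slide_corner OE ceE.
Qed.

Local Lemma sss_oppE (z : dart m1) : kept e z ->
  @opp m1 z = (if fopp (if z is inl x then x else e) == e then inr false
               else inl (fopp (if z is inl x then x else e))).
Proof.
case: z => [x|[]] kz //; last first.
  have lastE : last e s = E k.-1 by rewrite (last_nth e).
  rewrite /= lastE; have -> : fopp e = opp (E k.-1) by exact: oppE0.
  by rewrite ifN //; apply: dark_neq; apply: darkD.
rewrite keptE in kz.
rewrite /=; case: ifP => [xls|xn].
  have [i lt xE] := inE_ls xls; subst x.
  case: i lt xls kz => [|i] lt xls kz; first by rewrite eqxx in kz.
  have -> : fopp (E i.+1) = opp (E i) by exact: oppES.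
  have /negbTE -> := dark_neq (darkD (ltnW lt)).
  have -> : (if e == E i.+1 then 0 else (index (E i.+1) s).+1) = i.+1.
    by have := index_uniq e lt uniq_ls.
  have lt' : i < size ls by exact: ltnW.
  by congr inl; exact: (nth_map e (E i.+1) opp lt').
have xds : (x \in opp e :: [seq opp e0 | e0 <- s]) = (opp x \in ls).
  by rewrite -[RHS](mem_map (opp_inj oppK)) oppK.
rewrite xds; case: ifP => [oxl|oxn]; last first.
  have -> : fopp x = opp x by apply: oppN; [rewrite xn | rewrite oxn].
  by rewrite ifN //; apply: ls_neq; rewrite oxn.
have [i lt oxE] := inE_ls oxl; have {}oxE : x = opp (E i) by rewrite -oxE oppK.
subst x.
have -> : (if opp e == opp (E i) then 0
           else (index (opp (E i)) [seq opp e0 | e0 <- s]).+1) = i.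
  have := @index_map _ _ _ (opp_inj oppK) ls (E i).
  by rewrite /= => ->; have := index_uniq e lt uniq_ls.
case: ltnP => [lt'|ge].
  have -> : fopp (opp (E i)) = E i.+1 by exact: oppD.
  rewrite (negbTE (E'_neq lt')); congr inl; rewrite /E /=.
  exact: set_nth_default.
have -> : i = k.-1 by apply/eqP; rewrite -eqSS k_predK eqn_leq lt ge.
by have -> : fopp (opp (E k.-1)) = e by [exact: oppDl]; rewrite eqxx.
Qed.

Lemma restrict_slide :
  exists f : dart (restrict z0) -> dart m',
    [/\ bijective f, forall z, f (face z) = face (f z),
        forall z, f (opp z) = opp (f z), forall z, dark (f z) = dark z
      & f (@next_kept m1 (kept e) z0 (inr true)) = cc /\ f z0 = e].
Proof.
exists ret; split.
- pose back x : {z : dart m1 | kept e z} := insubd z0 (if x == e then inr false else inl x).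
  exists back => [z|x].
    apply: val_inj; rewrite val_insubd /ret; case: z => [[x|[]] kz] //=.
      have kx := kz; rewrite keptE in kx; rewrite (negbTE kx).
      by rewrite kz.
    by rewrite eqxx.
  rewrite /ret val_insubd; case: eqP => [->|/eqP xe] //=.
  by rewrite keptE xe.
- by move=> x /=; rewrite ret_next //; exact: valP.
- move=> x.
  have vE : val (@opp (restrict z0) x) =
      if fopp (ret x) == e then inr false else inl (fopp (ret x)).
    rewrite [LHS]val_insubd (sss_oppE (valP x)) -/(ret x).
    by case: eqP => // /eqP ne; rewrite keptE ne.
  by rewrite (ret_eq vE); case: eqP => [/esym|].
- move=> [[x|[]] kx] //=; have /andP[/negbTE-> _] := edge_e; by [].
by split; [exact: ret_corner | ].
Qed.

End Sliding.

(** * Isomorphisms *)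

Record map_iso (m m' : premap) (f : dart m -> dart m') : Prop := MapIso {
  iso_bij : bijective f;
  iso_face : forall x, f (face x) = face (f x);
  iso_opp : forall x, f (opp x) = opp (f x);
  iso_dark : forall x, dark (f x) = dark x
}.

Lemma map_iso_inv (m m' : premap) (f : dart m -> dart m') :
  map_iso f -> exists2 g, cancel f g & map_iso g.
Proof.
move=> [[g fK gK] ff fo fd]; exists g => //; split.
- by exists f.
- by move=> x; rewrite -{1}(gK x) -ff fK.
- by move=> x; rewrite -{1}(gK x) -fo fK.
by move=> x; rewrite -{2}(gK x) fd.
Qed.

Lemma isomorphic_sym q q' : isomorphic q q' -> isomorphic q' q.
Proof.
case=> qo [f [bf ff fo fd [fc fe]]]; split=> //.
have [g fK [bg gf go gd]] := map_iso_inv (MapIso bf ff fo fd).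
by exists g; split=> //; rewrite -fc -fe !fK.
Qed.

Lemma isomorphic_trans q2 q1 q3 :
  isomorphic q1 q2 -> isomorphic q2 q3 -> isomorphic q1 q3.
Proof.
case=> qo [f [bf ff fo fd [fc fe]]] [qo' [g [bg gf go gd [gc ge]]]].
split; first by rewrite qo.
exists (g \o f); split; rewrite /= ?fc ?fe ?gc ?ge //.
- exact: bij_comp.
- by move=> x; rewrite /= ff gf.
- by move=> x; rewrite /= fo go.
by move=> x; rewrite /= gd fd.
Qed.

Lemma fconnect_map (T U : finType) (f : T -> T) (g : U -> U) (h : T -> U) x y :
  injective h -> (forall z, h (f z) = g (h z)) -> fconnect g (h x) (h y) = fconnect f x y.
Proof.
move=> h_inj hf; have iterh n z : iter n g (h z) = h (iter n f z).
  by elim: n => //= n ->; rewrite hf.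
apply/idP/idP => /iter_findex.
  by rewrite iterh => /h_inj <-; apply: fconnect_iter.
by move=> <-; rewrite -iterh fconnect_iter.
Qed.

Section Transfer.
Variables (m m' : premap) (f : dart m -> dart m').
Hypotheses (f_iso : map_iso f) (m_face : injective (@face m)).
Let f_inj : injective f := bij_inj (iso_bij f_iso).
Let ff := iso_face f_iso.
Let fo := iso_opp f_iso.
Let fd := iso_dark f_iso.
Implicit Types x y u w h e : dart m.

Lemma iso_face_inj : injective (@face m').
Proof.
have [g fK gK] := iso_bij f_iso => x y.
by rewrite -(gK x) -(gK y) -!ff => /f_inj/m_face->.
Qed.

Lemma iso_same_vertex x y : same_vertex (f x) (f y) = same_vertex x y.
Proof. by apply: fconnect_map => // z; rewrite /node ff fo. Qed.

Lemma iso_dangling x : dangling (f x) = dangling x.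
Proof. by rewrite /dangling -fo (inj_eq f_inj). Qed.

Lemma iso_is_edge x : is_edge (f x) = is_edge x.
Proof. by rewrite /is_edge fd iso_dangling. Qed.

Lemma iso_src O x : src O (f x) = f (src O x). Proof. by case: O => /=. Qed.
Lemma iso_tgt O x : tgt O (f x) = f (tgt O x). Proof. by case: O => /=. Qed.
Lemma iso_edge_from O x : edge_from O (f x) = f (edge_from O x).
Proof. by case: O => /=. Qed.

Lemma iso_finv x : finv face (f x) = f (finv face x).
Proof. by apply: iso_face_inj; rewrite -ff !f_finv //; apply: iso_face_inj. Qed.

Lemma iso_turn O x : turn O (f x) = f (turn O x).
Proof. by case: O => /=; rewrite ?iso_finv /node -?fo -?ff. Qed.

Lemma iso_iter_turn O n x : iter n (turn O) (f x) = f (iter n (turn O) x).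
Proof. by elim: n => //= n ->; rewrite iso_turn. Qed.

Lemma iso_corner_start O x : corner_start O (f x) = f (corner_start O x).
Proof. by case: O => /=; rewrite ?iso_finv -?fo. Qed.

Lemma iso_corner_preceding O x : corner_preceding O (f x) = f (corner_preceding O x).
Proof. by case: O => /=. Qed.

Lemma iso_is_path O u s w : is_path O (f u) (map f s) (f w) = is_path O u s w.
Proof.
elim: s u => [|e s IH] u /=; first exact: iso_same_vertex.
by rewrite iso_is_edge iso_src iso_tgt iso_same_vertex IH.
Qed.

Lemma iso_dist O u w : dist O (f u) (f w) = dist O u w.
Proof.
have [g fK gK] := iso_bij f_iso.
rewrite /dist -(bij_eq_card (iso_bij f_iso)); apply: eq_find => n.
apply/existsP/existsP => -[s ps].
  exists (map_tuple g s); rewrite -iso_is_path /= -map_comp.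
  by rewrite (eq_map (_ : f \o g =1 id)) ?map_id.
by exists (map_tuple f s); rewrite /= iso_is_path.
Qed.

Lemma iso_is_lightest O h w s :
  is_lightest O h w s -> is_lightest O (f h) (f w) (map f s).
Proof.
have candf h' e : candidate O (f h') (f w) (f e) = candidate O h' w e.
  by rewrite /candidate iso_is_edge iso_tgt !iso_dist.
elim: s h => [|e s IH] h /=; first by rewrite iso_same_vertex.
case=> nhw ce [n hn nc] /IH{}IH; split.
- by rewrite iso_same_vertex.
- by rewrite candf.
- exists n => [|j /nc]; first by rewrite iso_src -hn -iso_iter_turn.
  by rewrite iso_iter_turn iso_edge_from candf.
by rewrite iso_tgt.
Qed.

Lemma iso_fcard (g : dart m -> dart m) (g' : dart m' -> dart m') :
  injective g -> injective g' -> (forall x, f (g x) = g' (f x)) ->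
  fcard g' (dart m') = fcard g (dart m).
Proof.
move=> g_inj g'_inj fg; have [h fK hK] := iso_bij f_iso.
have gsym := fconnect_sym g_inj; have gsym' := fconnect_sym g'_inj.
apply/eqP; rewrite eqn_leq; apply/andP; split.
  apply: (fcard_leq (h := fun x => froot g' (f x))) => // x.
    by apply/esym/(rootP gsym'); rewrite fg fconnect1.
  by exists (h x); rewrite hK.
apply: (fcard_leq (h := fun y : dart m' => froot g (h y))) => // x.
  apply/esym/(rootP gsym); rewrite -(fconnect_map _ _ f_inj fg) !hK.
  exact: fconnect1.
by exists (f x); rewrite fK.
Qed.

Lemma iso_card (P : pred (dart m)) (P' : pred (dart m')) :
  (forall x, P' (f x) = P x) -> #|P'| = #|P|.
Proof.
move=> PP; rewrite -(card_image f_inj); apply: eq_card => y.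
have [h fK hK] := iso_bij f_iso; rewrite -(hK y) mem_image //.
by rewrite -!topredE /= PP.
Qed.

Lemma iso_slide e c s : uniq s ->
  @map_iso (slide e c s) (slide (f e) (f c) (map f s)) f.
Proof.
move=> us; split=> /=; first exact: iso_bij.
- move=> x; rewrite /slide_face (inj_eq f_inj); case: eqP => _; first exact: ff.
  by rewrite !(inj_tperm _ _ _ f_inj) !ff.
- move=> x; rewrite /slide_opp mem_map // -fo mem_map //.
  case: ifP => _; first by rewrite prev_map // fo.
  by case: ifP => _ //; rewrite next_map.
exact: fd.
Qed.

Lemma iso_slide_corner e c O :
  slide_corner (f e) (f c) O = f (slide_corner e c O).
Proof.
by case: O => //=; rewrite -ff // (inj_eq f_inj); case: ifP.
Qed.

End Transfer.

Lemma phypermap_hyper p m : phypermap m p -> hyper m.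
Proof.
case=> [[bf oK _ _] df dop dn l1]; split=> //; first exact: bij_inj.
  by move=> x /dn[].
move=> x /l1 c1; have : 0 < #|[pred y | fconnect face x y & dangling y]| by rewrite c1.
by case/card_gt0P=> y; rewrite inE => /andP[]; exists y.
Qed.

Lemma iso_phypermap p m m' (f : dart m -> dart m') :
  map_iso f -> phypermap m p -> phypermap m' p.
Proof.
move=> f_iso ph; have hm := phypermap_hyper ph.
have face_inj := hyper_face hm; have oppK := hyper_opp hm.
case: ph => [[bf oK con pl] df dop dn l1].
have [g fK gK] := iso_bij f_iso; have f_inj := bij_inj (iso_bij f_iso).
have ff := iso_face f_iso; have fo := iso_opp f_iso; have fd := iso_dark f_iso.
have face'_inj := iso_face_inj f_iso face_inj.
have oppK' : involutive (@opp m') by move=> y; rewrite -(gK y) -!fo oK.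
split.
- split=> //; first exact: injF_bij.
    move=> x y; have := con (g x) (g y).
    case/connectP=> q; elim: q x => [|z q IH] x /=.
      by move=> _ /(congr1 f); rewrite !gK => ->; apply: connect0.
    case/andP=> xz zq lq; apply: connect_trans (_ : connect _ (f z) y).
      by apply: connect1; case/orP: xz => /eqP->; rewrite /= ?ff ?fo gK eqxx ?orbT.
    by apply: IH; rewrite fK.
  rewrite /planar (iso_fcard f_iso (node_inj face_inj oppK)); last first.
  - by move=> x; rewrite /node ff fo.
  - exact: node_inj.
  rewrite (iso_fcard f_iso face_inj face'_inj ff) pl; congr (_ + 2).
  apply/eqP; rewrite -(@eqn_pmul2r 2) // !fcard_opp //; apply/eqP.
  apply/esym; apply: (iso_card f_iso) => x.
  by rewrite /= -!topredE /= iso_dangling.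
- by move=> y; rewrite -(gK y) -ff !fd df.
- by move=> y; rewrite -(gK y) (iso_dangling f_iso) -fo !fd; apply: dop.
- move=> y; rewrite -(gK y) (iso_dangling f_iso) fd => /dn[nd <-]; split=> //.
  by apply: (iso_card f_iso) => x; apply: fconnect_map.
move=> y; rewrite -(gK y) fd => /l1 <-; apply: (iso_card f_iso) => x /=.
by rewrite (iso_dangling f_iso) (fconnect_map _ _ f_inj ff).
Qed.

Lemma iso_in_H p q q' : isomorphic q q' -> in_H p q -> in_H p q'.
Proof.
case=> qo [f [bf ff fo fd [fc fe]]] [ph lc ee lv].
have f_iso := MapIso bf ff fo fd.
split; first exact: iso_phypermap f_iso ph.
- by rewrite /is_light_corner -fc fd.
- by rewrite -fe (iso_is_edge f_iso).
by rewrite /leaving -qo -fc -fe (iso_tgt f_iso) (iso_src f_iso) !(iso_dist f_iso).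
Qed.

(** * The involution *)

(** For the reverse orientation, an edge leaving [c] goes one step closer to [c]. As the starting
    corner precedes [e], it is the first candidate met, and [Phi] does not fall into its default
    case. *)
Lemma leaving_lightest m O (c e : dart m) : hyper m -> is_edge e ->
    leaving O c e ->
  exists2 s, lightest_geodesic (reverse O) (corner_preceding (reverse O) e) c = e :: s
    & is_lightest (reverse O)
        (corner_start (reverse O) (corner_preceding (reverse O) e)) c (e :: s).
Proof.
move=> hm ee; have face_inj := hyper_face hm; have oppK := hyper_opp hm.
set O' := reverse O; set ce := corner_preceding _ _.
rewrite /leaving -!(dist_reverse face_inj oppK O _ c).
rewrite -(src_reverse O) -(tgt_reverse O) -/O' => /eqP lv.
have same_ce : same_vertex ce (src O' e) by apply: same_corner_preceding.
have lt : dist O' ce c < #|dart m|.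
  rewrite (distl face_inj oppK _ _ same_ce).
  have : dist O' (tgt O' e) c < #|dart m| by rewrite -lv dist_leq_card.
  case/dist_path=> s _ ps; apply: (@dist_lt_card _ _ _ (e :: s)).
  by rewrite /= ee same_vertex_refl.
have := lightest_geodesicP face_inj oppK lt; set h := corner_start _ _.
case gE : (lightest_geodesic _ _ _) => [|e1 s].
  move=> /= hc; have := same_corner_start face_inj oppK O' ce => /same_vertex_trans/(_ hc).
  rewrite (same_vertexl face_inj oppK _ same_ce) => /(dist0P O').
  by rewrite lv.
have tE : turn O' h = src O' e by apply: turn_corner_start.
move=> ls; suff e1E : e1 = e by rewrite e1E in ls *; exists s.
have [_ _ [n hn nc] _] := ls.
apply: (can_inj (srcK oppK O')); rewrite -hn -tE.
case: n hn nc => // n _ /(_ 0 isT) /=; rewrite tE srcK // /candidate ee /=.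
have same_h : same_vertex h (src O' e) by rewrite -tE same_turn.
by rewrite (distl face_inj oppK _ _ same_h) lv eqxx.
Qed.

Definition slide_quadruple (O : orientation) (m : premap) (e c : dart m) s :=
  @Quadruple O (slide e c (e :: s)) (slide_corner e c O) e.

Section PhiSlide.
Variables (q : quadruple) (s : seq (dart (q_map q))).
Let O := reverse (q_or q).
Let m := q_map q.
Let c := q_corner q.
Let e := q_edge q.
Let ce := corner_preceding O e.
Hypotheses (m_hyper : hyper m) (c_light : ~~ dark c).
Hypothesis lightest : is_lightest O (corner_start O ce) c (e :: s).

Lemma Phi_slide : isomorphic (Phi q) (slide_quadruple O e c s).
Proof.
have gE : lightest_geodesic O ce c = e :: s.
  by apply: lightest_geodesicE => //; [apply: hyper_face | apply: hyper_opp].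
rewrite /Phi -/O -/c -/e -/ce gE; split; first by [].
exact: (restrict_slide m_hyper lightest).
Qed.

Let m' := slide e c (e :: s).
Let cc := slide_corner e c O.

Lemma slide_planar : planar m -> planar m'.
Proof.
move=> pl.
have hm' : hyper m' := slide_hyper m_hyper c_light lightest.
have lc' : ~~ @dark m' cc by exact: (slide_light_corner m_hyper lightest).
have ls' := slide_lightest m_hyper c_light lightest.
have faceE x := slide_slide_face m_hyper lightest x.
have oppE x := slide_slide_opp m_hyper lightest x.
pose m'' := @slide m' e cc (e :: rev s).
rewrite /planar (slide_fcard_opp m_hyper lightest) -pl; congr (_ + _).
  apply/eqP; rewrite eqn_leq (slide_fcard_node m_hyper c_light lightest) andbT.
  have nodeE : @node m'' =1 @node m.
    by move=> x; apply: etrans (faceE _) (congr1 (@face m) (oppE x)).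
  by have := slide_fcard_node hm' lc' ls'; rewrite (eq_fcard nodeE).
apply/eqP; rewrite eqn_leq (slide_fcard_face m_hyper lightest) andbT.
by have := slide_fcard_face hm' ls'; rewrite (eq_fcard (faceE : @face m'' =1 @face m)).
Qed.

End PhiSlide.

Lemma in_H_lightest p q : in_H p q ->
  [/\ hyper (q_map q), ~~ dark (q_corner q)
    & exists s, is_lightest (reverse (q_or q))
        (corner_start (reverse (q_or q)) (corner_preceding (reverse (q_or q)) (q_edge q)))
        (q_corner q) (q_edge q :: s)].
Proof.
case=> ph lc ee lv; have hm := phypermap_hyper ph; split=> //.
by have [s _ ls] := leaving_lightest hm ee lv; exists s.
Qed.

Lemma slide_in_H p q s : in_H p q ->
    is_lightest (reverse (q_or q))
      (corner_start (reverse (q_or q)) (corner_preceding (reverse (q_or q)) (q_edge q)))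
      (q_corner q) (q_edge q :: s) ->
  in_H p (slide_quadruple (reverse (q_or q)) (q_edge q) (q_corner q) s).
Proof.
move=> qH ls; have [hm lc _] := in_H_lightest qH.
have [[[bf oK con pl] df dop dn l1] _ ee lv] := qH.
have hm' := slide_hyper hm lc ls.
split; last 3 first.
- exact: (slide_light_corner hm ls).
- exact: (slide_edge hm ls).
- exact: (slide_leaving hm lc ls).
split; first split.
- by apply: injF_bij; apply: hyper_face hm'.
- exact: hyper_opp hm'.
- exact: (slide_connected hm lc ls).
- exact: slide_planar.
- exact: hyper_dark_face hm'.
- exact: hyper_dark_opp hm'.
- move=> x dx; split; first exact: hyper_dark hm' _ dx.
  by rewrite (slide_order_dark hm lc ls dx); case: (dn x dx).
by move=> x lx; apply: (slide_dangling_card hm lc ls).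
Qed.

(** Each side is first replaced by a slide. An isomorphism transports slides as it is, since they
    keep the darts of the initial map. *)
Lemma Phi_iso p q q' : isomorphic q q' -> in_H p q -> isomorphic (Phi q) (Phi q').
Proof.
move=> qq' qH; have q'H := iso_in_H qq' qH.
have [hm lc [s ls]] := in_H_lightest qH; have [hm' lc' _] := in_H_lightest q'H.
have us : uniq (q_edge q :: s) := uniq_ls hm ls.
apply: isomorphic_trans (Phi_slide hm ls) _.
case: qq' => qo [f [bf ff fo fd [fc fe]]].
have f_iso := MapIso bf ff fo fd; have fi := hyper_face hm.
have ls' := iso_is_lightest f_iso fi ls.
rewrite -(iso_corner_start f_iso fi) -(iso_corner_preceding f_iso) /= fc fe qo in ls'.
apply: isomorphic_trans (isomorphic_sym (Phi_slide hm' ls')).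
split; first by rewrite /= qo.
have sl := iso_slide f_iso (q_edge q) (q_corner q) us.
have sc := iso_slide_corner f_iso (q_edge q) (q_corner q) (reverse (q_or q)).
case: sl => bs fs os ds; rewrite /= fc fe in bs fs os ds sc *.
by exists f; split=> //; rewrite -qo -sc.
Qed.

(* Plane maps are considered up to isomorphism, hence the first clause and the
   form of the last one. *)
Theorem theorem3p1 (p : nat) (hp : 2 <= p) :
  [/\ forall q q' : quadruple, isomorphic q q' -> in_H p q ->
        in_H p q' /\ isomorphic (Phi q) (Phi q'),
      forall q : quadruple, in_H p q -> in_H p (Phi q)
    & forall q : quadruple, in_H p q -> isomorphic (Phi (Phi q)) q].
Proof.
have PhiH q : in_H p q -> in_H p (Phi q).
  move=> qH; have [hm lc [s ls]] := in_H_lightest qH.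
  exact: iso_in_H (isomorphic_sym (Phi_slide hm ls)) (slide_in_H qH ls).
split=> // [q q' qq' qH | q qH].
  by split; [apply: iso_in_H qq' qH | apply: Phi_iso qq' qH].
have [hm lc [s ls]] := in_H_lightest qH.
(* Replacing [Phi q] by the slide makes the second application a slide on the darts of [q_map q], so
   that the final isomorphism is the identity. *)
apply: isomorphic_trans (Phi_iso (Phi_slide hm ls) (PhiH _ qH)) _.
have q1H := slide_in_H qH ls; have [hm1 lc1 _] := in_H_lightest q1H.
have ls1 := slide_lightest hm lc ls.
apply: isomorphic_trans (@Phi_slide (slide_quadruple _ _ _ _) _ hm1 ls1) _.
split; first exact: reverseK.
exists id; split=> //.
- by exists id.
- exact: (slide_slide_face hm ls).
- exact: (slide_slide_opp hm ls).
by split=> //; apply: (slide_slide_corner hm ls).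
Qed.
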